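(* The following hold (with value classifiers over arbitrary schemas). (1) $\max$-DHNs, simple $\max$-DHNs, UNFO, and HML all have the same expressive power. (2) Simple $\mathrm{sum}$-DHNs are at least as expressive as GHML and at least as expressive as UNFOC. (3) On databases of bounded degree (i.e. for every $B\ge 0$, on databases of degree at most $B$), the following three classes have the same expressive power: connected $\mathrm{sum}$-DHNs, simple connected $\mathrm{sum}$-DHNs, and connected GHML.
   Context: Databases. A schema $S$ is a finite set of relation symbols $R$ with arities $\mathrm{ar}(R)\ge 0$. An $S$-database $D$ is a finite set of facts $R(\bar v)$, $R\in S$, $\bar v$ an $\mathrm{ar}(R)$-tuple of values from a fixed countably infinite set; $\mathrm{adom}(D)$ is the set of values occurring in $D$. The degree of $D$ is the maximum number of facts that any value occurs in. A pointed database $D^v$ is a database with $v\in\mathrm{adom}(D)$. A pattern $F$ is a database together with a finite set $\mathrm{adom}(F)$ of values containing all values occurring in its facts (isolated values allowed); $F^w$ is a pattern with distinguished $w\in \mathrm{adom}(F)$. $\mathrm{Hom}(F^w,D^u)$ is the set of maps $h:\mathrm{adom}(F)\to\mathrm{adom}(D)$ with $h(w)=u$ and $R(\bar v)\in F\Rightarrow R(h(\bar v))\in D$. The Gaifman graph of $F$ has vertex set $\mathrm{adom}(F)$ and edges between distinct values occurring together in a fact. DHNs. An aggregation function maps finite multisets of reals to reals (e.g. sum, mean, max, with $\mathrm{mean}(\emptyset)=\max(\emptyset)=0$); applied to vectors component-wise. A homomorphism query of input dimension $d\ge 0$ and output dimension $d'>0$ is a triple $(F^w,\mu,\mathrm{agg})$,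 $F^w$ a pointed pattern, $\mu$ assigning to each $v\in\mathrm{adom}(F)$ a transformation function $\mu_v:\mathbb R^d\to\mathbb R^{d'}$, $\mathrm{agg}$ an aggregation function. On $D^u$ with embedding $\lambda:\mathrm{adom}(D)\to\mathbb R^d$ its result is $\mathrm{agg}\{\!\{\prod_{v\in\mathrm{adom}(F)}\mu_v(\lambda(h(v)))\mid h\in\mathrm{Hom}(F^w,D^u)\}\!\}$ (component-wise product). It is connected if the Gaifman graph of $F$ is connected. A DHN layer is a finite sequence of homomorphism queries of the same input dimension, with output dimensions $d_1,\dots,d_m$, and a combination function $\mathrm{com}:\mathbb R^{d_1}\times\dots\times\mathbb R^{d_m}\to\mathbb R^{d'}$; it maps $\lambda$ to the embedding sending $u$ to $\mathrm{com}$ applied to the results of the queries on $(D^u,\lambda)$. A DHN over $S$ is a sequence $(\mathcal L_1,\dots,\mathcal L_k,\mathrm{cls})$ of layers with matching dimensions, input dimension of $\mathcal L_1$ equal to $0$, and a classification function $\mathrm{cls}:\mathbb R^{d'}\to\{0,1\}$. Starting from the empty-vector embedding, apply the layers in order to get $\lambda^k$; the DHN accepts $D^v$ iff $\mathrm{cls}(\lambda^k(v))=1$. All these functions are arbitrary unless stated otherwise. An agg-DHN uses only the aggregation function agg; a DHN is connected if all its queries are. A DHN is simple if, with $\mathrm{ReLU}^*(x)=\min(\max(0,x),1)$ applied component-wise, every combination function has the form $\mathrm{ReLU}^*(\bar x_1A_1+\dots+\bar x_mA_m+\bar b)$, every transformation function the form $\mathrm{ReLU}^*(\bar xA+\bar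 b)$, with rational matrices and bias vectors, and $\mathrm{cls}(\bar x)=1$ iff $x_i\sim c$ for some fixed $i$, $c\in\mathbb Q$, ${\sim}\in\{>,\ge\}$. Logics (quantifiers range over $\mathrm{adom}(D)$; used as classifiers via formulas with one free variable). UNFOC: $\varphi(\bar x)::=R(\bar x)\mid\varphi\wedge\varphi\mid\varphi\vee\varphi\mid\exists^{\ge n}y\,\varphi(\bar x,y)\mid\neg\varphi(x_i)$, $n\in\mathbb N$, where in the last clause $\varphi$ has no free variable besides possibly $x_i$ ($R(\bar x)$ is a relational atom; no equality atoms). UNFO is the fragment with $n=1$ only. HML: $\varphi(x)::=\neg\varphi(x)\mid\varphi(x)\vee\varphi(x)\mid\exists\bar y\,\psi(x,\bar y)$, where $\psi$ is a conjunction of relational atoms over the variables $x,\bar y$ and of HML formulas $\varphi(z)$ with one free variable $z$ among $x,\bar y$ ($\bar y$ may be empty). GHML: as HML, but with $\exists\bar y\,\psi$ replaced by $\exists^{\ge k_1}y_1\cdots\exists^{\ge k_m}y_m\bigvee_{1\le i\le\ell}\psi_i(x,y_1,\dots,y_m)$, each $\psi_i$ of the same shape as $\psi$ in HML (with GHML formulas as unary conjuncts). A GHML formula is connected if in every such quantified subformula, for every $\psi_i$, some relational atom of $\psi_i$ uses $x$ and the Gaifman graph formed by the relational atoms of $\psi_i$, with all of $x,y_1,\dots,y_m$ as vertices, is connected. Expressive power. A classifier over $S$ expresses the set of pointed $S$-databases $D^v$ it accepts (a formula $\varphi(x)$ accepts $D^v$ iff $D\models\varphi(v)$). A class $\mathcal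 C_2$ is at least as expressive as $\mathcal C_1$ if every property expressible by a member of $\mathcal C_1$ is expressible by a member of $\mathcal C_2$; they have the same expressive power if each is at least as expressive as the other. ''On databases of degree at most $B$'' means that only acceptance of pointed databases of degree at most $B$ is considered.
   Formalization: In (1) the comparison with UNFO is stated for nonempty schemas (over the empty schema UNFO has no formulas); in (3) connected GHML requires all thresholds k_j ≥ 1, since with k_j = 0 a connected formula can say |adom(D)| ≥ 2, which connected DHNs cannot express. *)

(* Defs.v *)
From mathcomp Require Import all_boot all_order all_algebra.
From mathcomp Require Import finmap multiset.
From mathcomp Require Import reals.

Set Implicit Arguments.
Unset Strict Implicit.
Unset Printing Implicit Defensive.

Import Order.TTheory GRing.Theory Num.Theory.

Local Open Scope fset_scope.

Record schema := Schema { sym :> finType; ar : sym -> nat }.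

(* R(v_1, ..., v_ar(R)) over an arbitrary set V: a fact of a database when V is
   the set [nat] of values, a relational atom when V is a set of variables. *)
Definition fact (S : schema) (V : Type) : Type :=
  {R : sym S & (ar R).-tuple V}.

Definition fargs (S : schema) (V : Type) (f : fact S V) : seq V := tagged f.

Definition fact_map (S : schema) (V W : Type) (g : V -> W) (f : fact S V) :
  fact S W := existT _ (tag f) (map_tuple g (tagged f)).

Definition database (S : schema) : Type := {fset {R : sym S & (ar R).-tuple nat}}.

Definition adom (S : schema) (D : database S) : {fset nat} :=
  \bigcup_(f <- D) [fset v in fargs f].

Definition degree (S : schema) (D : database S) : nat :=
  \max_(v : adom D) #|` [fset f in D | val v \in fargs f]|.

Definition gaifman (S : schema) (V : eqType) (A : seq (fact S V)) : rel V :=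
  fun v w => (v != w) && has (fun f => (v \in fargs f) && (w \in fargs f)) A.

Definition connected_graph (V : finType) (e : rel V) : bool :=
  [forall v, forall w, connect e v w].

Record pattern (S : schema) := Pattern {
  pfacts : database S;
  padom : {fset nat};
  padomP : adom pfacts `<=` padom }.

Definition connected_pattern (S : schema) (F : pattern S) : bool :=
  connected_graph (relpre (val : padom F -> nat) (gaifman (pfacts F : seq _))).

Definition is_hom (S : schema) (F : pattern S) (w : padom F)
    (D : database S) (u : adom D) (h : {ffun padom F -> adom D}) : bool :=
  (h w == u) &&
  [forall f : {R : sym S & (ar R).-tuple (padom F)},
    (fact_map val f \in pfacts F) ==> (fact_map (val \o h) f \in D)].

Definition Hom (S : schema) (F : pattern S) (w : padom F)
    (D : database S) (u : adom D) : {set {ffun padom F -> adom D}} :=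
  [set h | is_hom w u h].

Definition classifier (S : schema) := forall D : database S, adom D -> bool.

(* A class of classifiers, given by the properties its members express. *)
Definition class (S : schema) := classifier S -> Prop.

Definition at_least_as_expressive_on (S : schema) (P : database S -> Prop)
    (C2 C1 : class S) : Prop :=
  forall c1, C1 c1 ->
  exists2 c2, C2 c2 & forall (D : database S) (v : adom D), P D -> c1 D v = c2 D v.

Definition same_power_on (S : schema) (P : database S -> Prop)
    (C1 C2 : class S) : Prop :=
  at_least_as_expressive_on P C2 C1 /\ at_least_as_expressive_on P C1 C2.

Definition at_least_as_expressive (S : schema) (C2 C1 : class S) : Prop :=
  at_least_as_expressive_on (fun _ => True) C2 C1.

Definition same_power (S : schema) (C1 C2 : class S) : Prop :=
  same_power_on (fun _ => True) C1 C2.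

Definition aggregation (R : realType) := {mset R}%mset -> R.

Definition sum_agg (R : realType) : aggregation R :=
  fun s => (\sum_(x <- enum_mset s) x)%R.

(* The value [0] is used for the empty multiset only: the maximum of a nonempty
   multiset of negative numbers is negative. *)
Definition max_agg (R : realType) : aggregation R :=
  fun s => if enum_mset s is x :: t then \big[Num.max/x]_(y <- t) y else 0%R.

Record query (R : realType) (S : schema) (d : nat) := Query {
  qdim : nat;
  qdim_gt0 : 0 < qdim;
  qpat : pattern S;
  qpoint : padom qpat;
  qtrans : padom qpat -> 'rV[R]_d -> 'rV[R]_qdim;
  qagg : aggregation R }.

Arguments qtrans [R S d] q v x.

Definition query_eval (R : realType) (S : schema) (d : nat) (q : query R S d)
    (D : database S) (lam : adom D -> 'rV[R]_d) (u : adom D) : 'rV[R]_(qdim q) :=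
  (\row_j qagg q (seq_mset
     [seq \prod_(v : padom (qpat q)) qtrans q v (lam (h v)) ord0 j
        | h : {ffun padom (qpat q) -> adom D} <- enum (Hom (qpoint q) u)]))%R.

Record layer (R : realType) (S : schema) (d d' : nat) := Layer {
  lnum : nat;
  lquery : 'I_lnum -> query R S d;
  lcom : (forall i, 'rV[R]_(qdim (lquery i))) -> 'rV[R]_d' }.

Arguments lquery [R S d d'] l i.
Arguments lcom [R S d d'] l xs.

Definition layer_eval (R : realType) (S : schema) (d d' : nat)
    (L : layer R S d d') (D : database S) (lam : adom D -> 'rV[R]_d) :
  adom D -> 'rV[R]_d' :=
  fun u => lcom L (fun i => query_eval (lquery L i) lam u).

(* [layers R S d]: sequences of layers with matching dimensions, of input
   dimension 0 and output dimension [d]. *)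
Inductive layers (R : realType) (S : schema) : nat -> Type :=
| NoLayer : layers R S 0
| AddLayer d d' of layers R S d & layer R S d d' : layers R S d'.

Fixpoint layers_eval (R : realType) (S : schema) (d : nat) (N : layers R S d)
    (D : database S) : adom D -> 'rV[R]_d :=
  match N with
  | NoLayer => fun _ => 0%R
  | AddLayer _ _ N' L => layer_eval L (@layers_eval R S _ N' D)
  end.

Fixpoint all_layers (R : realType) (S : schema)
    (P : forall d d', layer R S d d' -> Prop) (d : nat) (N : layers R S d) : Prop :=
  match N with
  | NoLayer => True
  | AddLayer _ _ N' L => all_layers P N' /\ P _ _ L
  end.

Record dhn (R : realType) (S : schema) := DHN {
  ddim : nat;
  dlayers : layers R S ddim;
  dcls : 'rV[R]_ddim -> bool }.

Arguments dcls [R S] d x.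

Definition dhn_accepts (R : realType) (S : schema) (N : dhn R S) : classifier S :=
  fun D v => dcls N (layers_eval (dlayers N) v).

Definition uses_agg (R : realType) (S : schema) (agg : aggregation R)
    (N : dhn R S) : Prop :=
  all_layers (fun d d' (L : layer R S d d') => forall i, qagg (lquery L i) = agg)
    (dlayers N).

Definition connected_dhn (R : realType) (S : schema) (N : dhn R S) : Prop :=
  all_layers
    (fun d d' (L : layer R S d d') => forall i, connected_pattern (qpat (lquery L i)))
    (dlayers N).

Definition ReLUs (R : realType) (d : nat) (x : 'rV[R]_d) : 'rV[R]_d :=
  map_mx (fun t => Num.min (Num.max 0 t) 1)%R x.

Definition simple_trans (R : realType) (d d' : nat)
    (f : 'rV[R]_d -> 'rV[R]_d') : Prop :=
  exists (A : 'M[rat]_(d, d')) (b : 'rV[rat]_d'),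
    forall x, f x = ReLUs (x *m map_mx ratr A + map_mx ratr b)%R.

Definition simple_com (R : realType) (m : nat) (ds : 'I_m -> nat) (d' : nat)
    (f : (forall i, 'rV[R]_(ds i)) -> 'rV[R]_d') : Prop :=
  exists (A : forall i, 'M[rat]_(ds i, d')) (b : 'rV[rat]_d'),
    forall x, f x = ReLUs (\sum_i x i *m map_mx ratr (A i) + map_mx ratr b)%R.

Definition simple_cls (R : realType) (d : nat) (cls : 'rV[R]_d -> bool) : Prop :=
  exists (i : 'I_d) (c : rat),
    (forall x, cls x = (x ord0 i > ratr c)%R) \/
    (forall x, cls x = (x ord0 i >= ratr c)%R).

Definition simple_layer (R : realType) (S : schema) (d d' : nat)
    (L : layer R S d d') : Prop :=
  simple_com (lcom L) /\
  forall i v, simple_trans (qtrans (lquery L i) v).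

Definition simple_dhn (R : realType) (S : schema) (N : dhn R S) : Prop :=
  all_layers (@simple_layer R S) (dlayers N) /\ simple_cls (dcls N).

Definition agg_DHN (R : realType) (S : schema) (agg : aggregation R) : class S :=
  fun c => exists2 N : dhn R S, uses_agg agg N & c = dhn_accepts N.

Definition simple_agg_DHN (R : realType) (S : schema) (agg : aggregation R) :
  class S :=
  fun c => exists2 N : dhn R S, uses_agg agg N /\ simple_dhn N & c = dhn_accepts N.

Definition connected_agg_DHN (R : realType) (S : schema) (agg : aggregation R) :
  class S :=
  fun c => exists2 N : dhn R S,
    uses_agg agg N /\ connected_dhn N & c = dhn_accepts N.

Definition simple_connected_agg_DHN (R : realType) (S : schema)
    (agg : aggregation R) : class S :=
  fun c => exists2 N : dhn R S,
    [/\ uses_agg agg N, simple_dhn N & connected_dhn N] & c = dhn_accepts N.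

Arguments agg_DHN [R] S agg c.
Arguments simple_agg_DHN [R] S agg c.
Arguments connected_agg_DHN [R] S agg c.
Arguments simple_connected_agg_DHN [R] S agg c.

(* Variables are natural numbers. The side condition on negation is [unfoc_wf]. *)
Inductive unfoc (S : schema) : Type :=
| UAtom of fact S nat
| UAnd of unfoc S & unfoc S
| UOr of unfoc S & unfoc S
| UExists of nat & nat & unfoc S  (* [UExists n y phi] : at least n values y *)
| UNeg of unfoc S.

Fixpoint unfoc_fv (S : schema) (phi : unfoc S) : {fset nat} :=
  match phi with
  | UAtom f => [fset x in fargs f]
  | UAnd phi1 phi2 | UOr phi1 phi2 => unfoc_fv phi1 `|` unfoc_fv phi2
  | UExists _ y phi1 => unfoc_fv phi1 `\ y
  | UNeg phi1 => unfoc_fv phi1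
  end.

Fixpoint unfoc_wf (S : schema) (phi : unfoc S) : bool :=
  match phi with
  | UAtom _ => true
  | UAnd phi1 phi2 | UOr phi1 phi2 => unfoc_wf phi1 && unfoc_wf phi2
  | UExists _ _ phi1 => unfoc_wf phi1
  | UNeg phi1 => unfoc_wf phi1 && (#|` unfoc_fv phi1| <= 1)
  end.

Fixpoint is_unfo (S : schema) (phi : unfoc S) : bool :=
  match phi with
  | UAtom _ => true
  | UAnd phi1 phi2 | UOr phi1 phi2 => is_unfo phi1 && is_unfo phi2
  | UExists n _ phi1 => (n == 1) && is_unfo phi1
  | UNeg phi1 => is_unfo phi1
  end.

Fixpoint unfoc_sat (S : schema) (D : database S) (phi : unfoc S)
    (a : nat -> adom D) : bool :=
  match phi with
  | UAtom f => fact_map (val \o a) f \in D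
  | UAnd phi1 phi2 => unfoc_sat phi1 a && unfoc_sat phi2 a
  | UOr phi1 phi2 => unfoc_sat phi1 a || unfoc_sat phi2 a
  | UExists n y phi1 =>
      n <= #|[pred v : adom D | unfoc_sat phi1 [eta a with y |-> v]]|
  | UNeg phi1 => ~~ unfoc_sat phi1 a
  end.

(* As at most one variable is free, a constant assignment evaluates the formula. *)
Definition unfoc_accepts (S : schema) (phi : unfoc S) : classifier S :=
  fun D v => unfoc_sat phi (fun _ => v).

Definition UNFOC (S : schema) : class S :=
  fun c => exists2 phi : unfoc S,
    unfoc_wf phi /\ #|` unfoc_fv phi| <= 1 & c = unfoc_accepts phi.

Definition UNFO (S : schema) : class S :=
  fun c => exists2 phi : unfoc S,
    [/\ is_unfo phi, unfoc_wf phi & #|` unfoc_fv phi| <= 1]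
    & c = unfoc_accepts phi.

Arguments UNFOC : clear implicits.
Arguments UNFO : clear implicits.

(* A conjunction psi(x, y_1, ..., y_m) of relational atoms and of unary conjuncts
   phi(z), phi : X. The variables are 'I_m.+1: 0 is x and j > 0 is y_j. *)
Record conj (S : schema) (m : nat) (X : Type) := Conj {
  catoms : seq (fact S 'I_m.+1);
  cunary : seq ('I_m.+1 * X) }.

Definition conj_sat (S : schema) (D : database S) (m : nat) (X : Type)
    (sat : X -> adom D -> bool) (a : 'I_m.+1 -> adom D) (psi : conj S m X) : bool :=
  all (fun f => fact_map (val \o a) f \in D) (catoms psi) &&
  all (fun p => sat p.2 (a p.1)) (cunary psi).

(* Each formula has a single free variable, which is left implicit. *)
Inductive hml (S : schema) : Type :=
| HNeg of hml S
| HOr of hml S & hml S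
| HExists m of conj S m (hml S).

Fixpoint hml_sat (S : schema) (D : database S) (phi : hml S) (u : adom D) : bool :=
  match phi with
  | HNeg phi1 => ~~ hml_sat phi1 u
  | HOr phi1 phi2 => hml_sat phi1 u || hml_sat phi2 u
  | HExists m psi =>
      [exists ys : m.-tuple (adom D),
        conj_sat (@hml_sat S D) (fun i => nth u (u :: ys) i) psi]
  end.

Definition HML (S : schema) : class S :=
  fun c => exists phi : hml S, c = (fun D v => hml_sat phi v).

Inductive ghml (S : schema) : Type :=
| GNeg of ghml S
| GOr of ghml S & ghml S
| GExists (ks : seq nat) of seq (conj S (size ks) (ghml S)).

(* exists^{>= k_1} y_1 ... exists^{>= k_m} y_m, P [:: y_1; ...; y_m] *)
Fixpoint count_exists (T : finType) (ks : seq nat) (P : seq T -> bool) : bool :=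
  match ks with
  | [::] => P [::]
  | k :: ks' => k <= #|[pred y | count_exists ks' (fun ys => P (y :: ys))]|
  end.

Fixpoint ghml_sat (S : schema) (D : database S) (phi : ghml S) (u : adom D) : bool :=
  match phi with
  | GNeg phi1 => ~~ ghml_sat phi1 u
  | GOr phi1 phi2 => ghml_sat phi1 u || ghml_sat phi2 u
  | GExists ks psis =>
      count_exists ks (fun ys : seq (adom D) =>
        has (conj_sat (@ghml_sat S D) (fun i => nth u (u :: ys) i)) psis)
  end.

Definition conj_connected (S : schema) (m : nat) (X : Type) (psi : conj S m X) :
  bool :=
  has (fun f => ord0 \in fargs f) (catoms psi) &&
  connected_graph (gaifman (catoms psi)).

(* The thresholds have to be positive here: as exists^{>= 0} ignores its body,
   exists^{>= 2} y_1 exists^{>= 0} y_2 R(x, y_1, y_2) would merely say that there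
   are at least two values, however far from x. *)
Fixpoint ghml_connected (S : schema) (phi : ghml S) : bool :=
  match phi with
  | GNeg phi1 => ghml_connected phi1
  | GOr phi1 phi2 => ghml_connected phi1 && ghml_connected phi2
  | GExists ks psis =>
      all (fun k => 0 < k) ks &&
      all (fun psi => conj_connected psi &&
                      all (fun p => ghml_connected p.2) (cunary psi)) psis
  end.

Definition GHML (S : schema) : class S :=
  fun c => exists phi : ghml S, c = (fun D v => ghml_sat phi v).

Definition connected_GHML (S : schema) : class S :=
  fun c => exists2 phi : ghml S, ghml_connected phi & c = (fun D v => ghml_sat phi v).

Arguments HML : clear implicits.
Arguments GHML : clear implicits.
Arguments connected_GHML : clear implicits.

(* Main.v *)
(* The proof goes through classes of classifiers that are closed under negation,
   disjunction and existential quantification over conjunctions of atoms and of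
   unary members of the class, possibly with inequalities. A formula of UNFOC or
   GHML is a disjunction of such existential conjunctions, [exists^{>= n} y]
   being replaced by [n] distinct copies of [y]; no inequality is needed when
   [n = 1], and connectedness is preserved. So every class with these closure
   properties contains the corresponding logic.

   Simple networks have these closure properties: a layer computes the number
   of homomorphisms (or, for max, whether there is one) satisfying some Boolean
   conditions, and ReLU* turns a positive count into 1. For sum, inequalities
   are removed by inclusion-exclusion over quotients of the pattern.

   Conversely, the result of a query is a function of the numbers of
   homomorphisms of each type, where the type of a homomorphism records the
   finitely many possible values of the embedding at its vertices. For max only
   the set of realized types matters. For sum these numbers are bounded when the
   pattern is connected and the degree is bounded, and the number of tuples
   [(y_1, ..., y_m)] satisfying [psi] is the number of tuples of positive
   [(k_1, ..., k_m)] such that [exists^{>= k_1} y_1 ... exists^{>= k_m} y_m psi]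
   holds. *)
Require Import Defs.
From mathcomp Require Import all_boot all_order all_algebra.
From mathcomp Require Import finmap multiset.
From mathcomp Require Import boolp reals lra.

Set Implicit Arguments.
Unset Strict Implicit.
Unset Printing Implicit Defensive.

(** * Conjunctive queries and closed classes of classifiers *)

Section Facts.
Variable S : schema.

Lemma fact_map_comp (U V W : Type) (g : V -> W) (f : U -> V) (a : fact S U) :
  fact_map g (fact_map f a) = fact_map (g \o f) a.
Proof.
case: a => R t; rewrite /fact_map /=; congr existT.
by apply: val_inj; rewrite /= map_comp.
Qed.

Lemma eq_fact_map (V W : Type) (f g : V -> W) : f =1 g ->
  @fact_map S V W f =1 fact_map g.
Proof.
move=> e [R t]; rewrite /fact_map /=; congr existT.
by apply: val_inj; rewrite /=; apply: eq_map.
Qed.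

Lemma fargs_map (V W : Type) (g : V -> W) (a : fact S V) :
  fargs (fact_map g a) = [seq g x | x <- fargs a].
Proof. by []. Qed.

(** [connect] exists over finite types only, whereas variables here also range over [nat] and over
    sums [X + V] with [X] infinite; hence explicit paths over any [eqType]. *)
Definition reach (V : eqType) (e : rel V) (x y : V) : Prop :=
  exists2 p, path e x p & last x p = y.

Lemma reach_refl (V : eqType) (e : rel V) x : reach e x x.
Proof. by exists [::]. Qed.

Lemma reach_trans (V : eqType) (e : rel V) y x z :
  reach e x y -> reach e y z -> reach e x z.
Proof.
move=> [p ep lp] [q eq lq]; exists (p ++ q); first by rewrite cat_path ep lp.
by rewrite last_cat lp.
Qed.

(** An edge may collapse to a single vertex, so paths survive substitutions and quotients that are
    not injective. *)
Lemma reach_map (V W : eqType) (e : rel V) (e' : rel W) (f : V -> W) x y :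
  (forall v w, e v w -> (f v == f w) || e' (f v) (f w)) ->
  reach e x y -> reach e' (f x) (f y).
Proof.
move=> ee' [p]; elim: p x => [|z p IH] x /=; first by move=> _ ->; apply: reach_refl.
case/andP=> /ee' exz ep lp; have := IH _ ep lp.
case/orP: exz => [/eqP-> //|exz]; apply: reach_trans.
by exists [:: f z]; rewrite //= exz.
Qed.

Lemma reach_sym (V : eqType) (e : rel V) x y :
  symmetric e -> reach e x y -> reach e y x.
Proof.
move=> se [p]; elim: p x => [|z p IH] x /=; first by move=> _ ->; apply: reach_refl.
case/andP=> exz ep lp; apply: reach_trans (IH _ ep lp) _.
by exists [:: x]; rewrite //= se exz.
Qed.

Lemma reachP (V : finType) (e : rel V) x y : connect e x y <-> reach e x y.
Proof.
split; first by case/connectP=> p ep ->; exists p.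
by case=> p ep lp; apply/connectP; exists p.
Qed.

Lemma gaifman_sym (V : eqType) (A : seq (fact S V)) : symmetric (gaifman A).
Proof.
move=> v w; rewrite /gaifman eq_sym; congr (_ && _).
by apply: eq_has => f; rewrite andbC.
Qed.

Lemma gaifman_map (V W : eqType) (f : V -> W) (A : seq (fact S V)) v w :
  gaifman A v w -> (f v == f w) || gaifman [seq fact_map f a | a <- A] (f v) (f w).
Proof.
case/andP=> _ /hasP[/= a Aa /andP[va wa]]; rewrite /gaifman; case: eqP => //= _.
rewrite has_map; apply/hasP; exists a => //=.
by rewrite !fargs_map !map_f.
Qed.

Lemma gaifman_sub (V : eqType) (A B : seq (fact S V)) v w :
  {subset A <= B} -> gaifman A v w -> gaifman B v w.
Proof.
move=> AB /andP[vw /hasP[a Aa ha]]; rewrite /gaifman vw.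
by apply/hasP; exists a => //; apply: AB.
Qed.

Lemma reach_gaifman_map (V W : eqType) (f : V -> W) (A : seq (fact S V)) x y :
  reach (gaifman A) x y -> reach (gaifman [seq fact_map f a | a <- A]) (f x) (f y).
Proof. by apply: reach_map => v w; apply: gaifman_map. Qed.

Lemma reach_gaifman_sub (V : eqType) (A B : seq (fact S V)) x y :
  {subset A <= B} -> reach (gaifman A) x y -> reach (gaifman B) x y.
Proof.
by move=> AB; apply: (@reach_map _ _ _ _ id) => v w /(gaifman_sub AB) ->; rewrite orbT.
Qed.

Lemma connected_graphP (V : finType) (A : seq (fact S V)) (x : V) :
  (forall y, reach (gaifman A) x y) <-> connected_graph (gaifman A).
Proof.
split=> [r|/forallP c y].
  apply/forallP=> v; apply/forallP=> w; apply/reachP.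
  by apply: (reach_trans _ (r w)); apply: reach_sym (r v); apply: gaifman_sym.
by apply/reachP; move/forallP: (c x); apply.
Qed.

End Facts.

(** * Classes of classifiers closed under conjunctive queries *)

Section Closed.
Variables (S : schema) (K : class S).

(** Unary conjuncts carry their proof of membership in [K], so that conjunctions are built directly
    from classifiers already known to belong to the class. *)
Record cconj (T : Type) := CConj {
  ats : seq (fact S T);
  uns : seq (T * {c : classifier S | K c});
  nqs : seq (T * T) }.

Definition cc_sat (D : database S) (T : Type) (q : cconj T) (a : T -> adom D) :=
  [&& all (fun f => fact_map (val \o a) f \in D) (ats q),
      all (fun p => sval p.2 D (a p.1)) (uns q)
    & all (fun p => a p.1 != a p.2) (nqs q)].

Definition cc_map (T T' : Type) (s : T -> T') (q : cconj T) : cconj T' :=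
  CConj [seq fact_map s f | f <- ats q] [seq (s p.1, p.2) | p <- uns q]
        [seq (s p.1, s p.2) | p <- nqs q].

Definition cc_cat (T : Type) (q1 q2 : cconj T) : cconj T :=
  CConj (ats q1 ++ ats q2) (uns q1 ++ uns q2) (nqs q1 ++ nqs q2).

Lemma cc_sat_map D T T' (s : T -> T') (q : cconj T) (a : T' -> adom D) :
  cc_sat (cc_map s q) a = cc_sat q (a \o s).
Proof.
rewrite /cc_sat /= !all_map; congr [&& _, _ & _].
by apply: eq_all => f /=; rewrite fact_map_comp.
Qed.

Lemma cc_sat_cat D T (q1 q2 : cconj T) (a : T -> adom D) :
  cc_sat (cc_cat q1 q2) a = cc_sat q1 a && cc_sat q2 a.
Proof.
by rewrite /cc_sat /= !all_cat !andbA; do !case: all.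
Qed.

Lemma eq_cc_sat D T (q : cconj T) (a a' : T -> adom D) :
  a =1 a' -> cc_sat q a = cc_sat q a'.
Proof.
move=> e; rewrite /cc_sat; congr [&& _, _ & _].
- by apply: eq_all => f; rewrite (@eq_fact_map _ _ _ _ (val \o a')) // => x /=;
  rewrite e.
- by apply: eq_all => p; rewrite e.
- by apply: eq_all => p; rewrite !e.
Qed.

Lemma cc_sat_imp D T (q : cconj T) (a a' : T -> adom D) :
  a =1 a' -> cc_sat q a -> cc_sat q a'.
Proof. by move=> /eq_cc_sat->. Qed.

(** The free variable is a vertex [pt] of the pattern, as in pointed homomorphisms, and not a
    separate variable. *)
Definition ex_cls (V : finType) (pt : V) (q : cconj V) : classifier S :=
  fun D u => [exists h : {ffun V -> adom D}, (h pt == u) && cc_sat q h].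

(* [b] allows inequalities and [cn] restricts to connected conjunctions. *)
Record cq_closed (b cn : bool) : Prop := CqClosed {
  closed_ext : forall c c', K c -> (forall D v, c D v = c' D v) -> K c';
  closed_true : K (fun _ _ => true);
  closed_neg : forall c, K c -> K (fun D v => ~~ c D v);
  closed_or : forall c c', K c -> K c' -> K (fun D v => c D v || c' D v);
  closed_ex : forall (V : finType) (pt : V) (q : cconj V),
    (~~ b -> nqs q = [::]) ->
    (cn -> forall v, reach (gaifman (ats q)) pt v) ->
    K (ex_cls pt q) }.

Section BoolClosed.
Variables (b cn : bool).
Hypothesis cK : cq_closed b cn.

Lemma closed_false : K (fun _ _ => false).
Proof. by apply: (closed_ext cK (closed_neg cK (closed_true cK))). Qed.

Lemma closed_has (I : Type) (s : seq I) (c : I -> classifier S) :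
  (forall i, K (c i)) -> K (fun D v => has (fun i => c i D v) s).
Proof.
move=> kc; elim: s => [|i s IH]; first exact: closed_false.
by apply: (closed_ext cK (closed_or cK (kc i) IH)).
Qed.

Lemma closed_exists (I : finType) (c : I -> classifier S) :
  (forall i, K (c i)) -> K (fun D v => [exists i, c i D v]).
Proof.
move=> kc; apply: (closed_ext cK (closed_has (enum I) kc)) => D v.
by apply/hasP/existsP => [[i _ h]|[i h]]; exists i; rewrite ?mem_enum.
Qed.

Lemma closed_forall (I : finType) (c : I -> classifier S) :
  (forall i, K (c i)) -> K (fun D v => [forall i, c i D v]).
Proof.
move=> kc; have k := closed_exists (fun i => closed_neg cK (kc i)).
apply: (closed_ext cK (closed_neg cK k)) => D v.
by rewrite negb_exists; apply: eq_forallb => i; rewrite negbK.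
Qed.

Lemma closed_if (e : bool) c : K c -> K (fun D v => c D v == e).
Proof.
case: e => kc; first by apply: (closed_ext cK kc) => D v; rewrite eqb_id.
by apply: (closed_ext cK (closed_neg cK kc)) => D v; rewrite eqbF_neg.
Qed.

End BoolClosed.

(** * Normal forms: disjunctions of existential conjunctions *)

Section NF.
Variables (b cn : bool).

Definition rel_on (X : Type) := forall D : database S, (X -> adom D) -> bool.

Definition sumf (X V A : Type) (a : X -> A) (h : V -> A) (x : X + V) : A :=
  match x with inl x => a x | inr v => h v end.

Definition inZ (X V : Type) (Z : pred X) (z : X + V) : bool :=
  if z is inl x then Z x else true.

Definition good (X : eqType) (x0 : X) (Z : pred X) (V : finType)
    (q : cconj (X + V)) : Prop :=
  (~~ b -> nqs q = [::]) /\
  (cn -> forall z, inZ Z z ->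
     reach (@gaifman S (X + V)%type (ats q)) (inl x0) z).

(* rho is a disjunction of existentially quantified conjunctions whose free
   variables in Z and bound variables are all connected to x0. *)
Inductive nf (X : eqType) (x0 : X) (Z : pred X) (rho : rel_on X) : Prop :=
| nf_cq (V : finType) (q : cconj (X + V)) of good x0 Z q
    & (forall D a, rho D a = [exists h : {ffun V -> adom D}, cc_sat q (sumf a h)])
| nf_false of (forall D a, rho D a = false)
| nf_or rho1 rho2 of nf x0 Z rho1 & nf x0 Z rho2
    & (forall D a, rho D a = rho1 D a || rho2 D a).

Lemma nf_ext (X : eqType) (x0 : X) Z rho rho' :
  nf x0 Z rho -> (forall D a, rho' D a = rho D a) -> nf x0 Z rho'.
Proof.
case=> [V q gq e|e|rho1 rho2 n1 n2 e] e'.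
- by apply: nf_cq gq _ => D a; rewrite e' e.
- by apply: nf_false => D a; rewrite e' e.
- by apply: nf_or n1 n2 _ => D a; rewrite e' e.
Qed.

Lemma nf_sub (X : eqType) (x0 : X) (Z Z' : pred X) rho :
  nf x0 Z rho -> (cn -> forall x, Z' x -> Z x) -> nf x0 Z' rho.
Proof.
move=> n sZ; elim: n => {rho}[rho V q [gb gc] e|rho e|rho rho1 rho2 _ n1 _ n2 e].
- apply: nf_cq e; split=> // c [x|v] /= zx; apply: gc => //=; exact: sZ.
- exact: nf_false.
- exact: nf_or n1 n2 e.
Qed.

(** Conjunction distributes over the disjunctions. Two existential conjunctions are joined over the
    disjoint union of their bound variables, and both stay linked through the shared variable
    [x0]. *)
Lemma nf_and (X : eqType) (x0 : X) (Z1 Z2 : pred X) rho1 rho2 :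
  nf x0 Z1 rho1 -> nf x0 Z2 rho2 ->
  nf x0 [predU Z1 & Z2] (fun D a => rho1 D a && rho2 D a).
Proof.
move=> n1 n2; elim: n1 => {rho1}[rho1 V1 q1 [gb1 gc1] e1|rho1 e1|rho1 r r' _ IH _ IH'
  e].
- elim: n2 => {rho2}[rho2 V2 q2 [gb2 gc2] e2|rho2 e2|rho2 r r' _ IH _ IH' e].
  + pose s1 (z : X + V1) : X + (V1 + V2) :=
      match z with inl x => inl x | inr v => inr (inl v) end.
    pose s2 (z : X + V2) : X + (V1 + V2) :=
      match z with inl x => inl x | inr v => inr (inr v) end.
    apply: (@nf_cq _ _ _ _ (V1 + V2)%type (cc_cat (cc_map s1 q1) (cc_map s2 q2))).
      split=> [nb|c z Zz] /=; first by rewrite gb1 // gb2.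
      have r1 z' : inZ Z1 z' ->
        reach (@gaifman S (X + (V1 + V2))%type ([seq fact_map s1 f | f <- ats q1]
          ++ [seq fact_map s2 f | f <- ats q2])) (inl x0) (s1 z').
        move/(gc1 c)/(@reach_gaifman_map S _ (X + (V1 + V2))%type s1).
        by apply: reach_gaifman_sub => f ff; rewrite mem_cat ff.
      have r2 z' : inZ Z2 z' ->
        reach (@gaifman S (X + (V1 + V2))%type ([seq fact_map s1 f | f <- ats q1]
          ++ [seq fact_map s2 f | f <- ats q2])) (inl x0) (s2 z').
        move/(gc2 c)/(@reach_gaifman_map S _ (X + (V1 + V2))%type s2).
        by apply: reach_gaifman_sub => f ff; rewrite mem_cat ff orbT.
      case: z Zz => [x /orP[]|[v|v] _]; first exact: (r1 (inl x)).
      * exact: (r2 (inl x)).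
      * exact: (r1 (inr v)).
      * exact: (r2 (inr v)).
    move=> D a; rewrite e1 e2;
      apply/andP/existsP => [[/existsP[h1 s_1] /existsP[h2 s_2]]|].
      exists [ffun v => sumf h1 h2 v]; rewrite cc_sat_cat !cc_sat_map.
      by apply/andP; split; [apply: cc_sat_imp s_1|apply: cc_sat_imp s_2];
        case=> // v /=; rewrite ffunE.
    case=> h; rewrite cc_sat_cat !cc_sat_map => /andP[s_1 s_2]; split; apply/existsP.
      exists [ffun v => h (inl v)].
      by apply: cc_sat_imp s_1; case=> // v /=; rewrite ffunE.
    exists [ffun v => h (inr v)].
    by apply: cc_sat_imp s_2; case=> // v /=; rewrite ffunE.
  + by apply: nf_false => D a; rewrite e2 andbF.
  + by apply: nf_or IH IH' _ => D a; rewrite e andb_orr.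
- by apply: nf_false => D a; rewrite e1.
- by apply: nf_or IH IH' _ => D a; rewrite e andb_orl.
Qed.

(** Paths from [x0] map to paths from [s x0], even when [s] identifies variables, so the reachable
    variables of the result are images of reachable ones. *)
Lemma nf_subst (X Y : eqType) (s : X -> Y) (x0 : X) (y0 : Y) (Z : pred X)
    (Z' : pred Y) rho : nf x0 Z rho ->
  (cn -> y0 = s x0 /\ forall y, Z' y -> exists2 x, Z x & y = s x) ->
  nf y0 Z' (fun D a => rho D (a \o s)).
Proof.
move=> n sZ; elim: n => {rho}[rho V q [gb gc] e|rho e|rho rho1 rho2 _ n1 _ n2 e].
- pose s' (z : X + V) : Y + V := match z with inl x => inl (s x) | inr v => inr v end.
  apply: (@nf_cq _ _ _ _ V (cc_map s' q)).
    split=> [nb|c z Zz] /=; first by rewrite gb.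
    have [-> {}sZ] := sZ c.
    have r1 z' : inZ Z z' ->
      reach (@gaifman S (Y + V)%type [seq fact_map s' f | f <- ats q]) (inl (s x0))
        (s' z').
      by move/(gc c)/(@reach_gaifman_map S _ (Y + V)%type s').
    case: z Zz => [y /sZ[x Zx ->]|v _]; first exact: (r1 (inl x)).
    exact: (r1 (inr v)).
  by move=> D a; rewrite e; apply: eq_existsb => h; rewrite cc_sat_map;
    apply: eq_cc_sat => -[].
- by apply: nf_false => D a; rewrite e.
- by apply: nf_or n1 n2 _ => D a; rewrite e.
Qed.

(** The variables of [Y] become bound. As bound variables have to be reachable when [cn] holds, [Y]
    must then lie inside [Z]. *)
Lemma nf_ex (X : eqType) (Y : finType) (x0 : X) (Z : pred (X + Y)) rho :
  @nf (X + Y)%type (inl x0) Z rho -> (cn -> forall y, Z (inr y)) ->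
  nf x0 (fun x => Z (inl x))
     (fun D a => [exists h : {ffun Y -> adom D}, rho D (sumf a h)]).
Proof.
move=> n sZ; elim: n => {rho}[rho V q [gb gc] e|rho e|rho rho1 rho2 _ n1 _ n2 e].
- pose s' (z : X + Y + V) : X + (Y + V) :=
    match z with inl (inl x) => inl x | inl (inr y) => inr (inl y)
            | inr v => inr (inr v) end.
  apply: (@nf_cq _ _ _ _ (Y + V)%type (cc_map s' q)).
    split=> [nb|c z Zz] /=; first by rewrite gb.
    have r1 z' : inZ Z z' ->
      reach (@gaifman S (X + (Y + V))%type [seq fact_map s' f | f <- ats q]) (inl x0)
        (s' z').
      by move/(gc c)/(@reach_gaifman_map S _ (X + (Y + V))%type s').
    case: z Zz => [x Zx|[y|v] _]; first exact: (r1 (inl (inl x))).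
      by apply: (r1 (inl (inr y))); apply: sZ.
    exact: (r1 (inr v)).
  move=> D a; apply/existsP/existsP => [[h]|[h]].
    rewrite e => /existsP[h' sh]; exists [ffun v => sumf h h' v].
    rewrite cc_sat_map; apply: cc_sat_imp sh.
    by case=> [[]|] //= y; rewrite ffunE.
  rewrite cc_sat_map => sh; exists [ffun y => h (inl y)]; rewrite e; apply/existsP.
  exists [ffun y => h (inr y)]; apply: cc_sat_imp sh.
  by case=> [[]|] //= y; rewrite ffunE.
- by apply: nf_false => D a; apply/existsP => -[h]; rewrite e.
- apply: nf_or n1 n2 _ => D a; apply/existsP/orP=> [[h]|].
    by rewrite e => /orP[]; [left|right]; apply/existsP; exists h.
  by case=> /existsP[h hh]; exists h; rewrite e hh ?orbT.
Qed.

Lemma void_exists (A : finType) (P : {ffun void -> A} -> bool) (b' : bool) :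
  (forall h, P h = b') -> [exists h, P h] = b'.
Proof.
move=> e; apply/existsP/idP => [[h]|bb]; first by rewrite e.
by exists [ffun v : void => match v with end]; rewrite e.
Qed.

Lemma nf_base (X : eqType) (x0 : X) (q : cconj X) (Z : pred X) :
  (~~ b -> nqs q = [::]) ->
  (cn -> forall z, Z z -> reach (gaifman (ats q)) x0 z) ->
  nf x0 Z (fun D a => cc_sat q a).
Proof.
move=> gb gc.
pose s (x : X) : X + void := inl x.
apply: (@nf_cq _ _ _ _ void (cc_map s q)).
  split=> [nb|c [x|[]]] /=; first by rewrite gb.
  by move/(gc c)/(@reach_gaifman_map S _ (X + void)%type s).
by move=> D a; apply/esym/void_exists => h; rewrite cc_sat_map; apply: eq_cc_sat.
Qed.

Lemma nf_true (X : eqType) (x0 : X) : nf x0 (pred1 x0) (fun D a => true).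
Proof.
apply: (@nf_ext _ _ _ (fun D a => cc_sat (CConj [::] [::] [::]) a)) => //.
by apply: nf_base => // _ z /eqP->; apply: reach_refl.
Qed.

Lemma nf_all (X : eqType) (x0 : X) (I : eqType) (s : seq I) (Z : I -> pred X)
    (rho : I -> rel_on X) : (forall i, i \in s -> nf x0 (Z i) (rho i)) ->
  nf x0 (fun x => (x == x0) || has (fun i => Z i x) s)
    (fun D a => all (fun i => rho i D a) s).
Proof.
elim: s => [|i s IH] ns /=.
  by apply: nf_sub (nf_true x0) _ => _ x; rewrite orbF.
have n1 := ns i (mem_head i s).
have n2 := IH (fun j js => ns j (@mem_behead _ (i :: s) j js)).
apply: nf_sub (nf_and n1 n2) _ => _ x /=.
by rewrite orbCA.
Qed.

(** The hypothesis is a conjunction along [s] and not a statement about its members, since [I] will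
    be a type of formulas without decidable equality. *)
Lemma nf_has (X : eqType) (x0 : X) (Z : pred X) (I : Type) (s : seq I)
    (rho : I -> rel_on X) :
  foldr (fun i P => nf x0 Z (rho i) /\ P) True s ->
  nf x0 Z (fun D a => has (fun i => rho i D a) s).
Proof.
elim: s => [_|i s IH [n1 /IH n2]]; first exact: nf_false.
by apply: nf_or n1 n2 _.
Qed.

Lemma leq_card_ffun (T : finType) (P : pred T) n :
  (n <= #|P|) = [exists h : {ffun 'I_n -> T}, injectiveb h && [forall j, P (h j)]].
Proof.
apply/idP/existsP => [le|[h /andP[/injectiveP ih /forallP Ph]]].
  exists [ffun j => enum_val (widen_ord le j)]; apply/andP; split.
    apply/injectiveP=> j k; rewrite !ffunE => /enum_val_inj e.
    by apply: val_inj; move/(congr1 val): e.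
  by apply/forallP=> j; rewrite ffunE; apply: (enum_valP (widen_ord le j)).
have <- : #|codom h| = n by rewrite card_codom // card_ord.
by apply: subset_leq_card; apply/subsetP=> x /codomP[j ->]; apply: Ph.
Qed.

(** Only pairs with [j < k] yield an inequality, so for [n <= 1] the conjunction is empty and is
    allowed even when inequalities are not. *)
Lemma nf_injective (X : eqType) (x0 : X) n : (~~ b -> n <= 1) ->
  @nf (X + 'I_n)%type (inl x0) (pred1 (inl x0))
    (fun D a => injectiveb (fun j => a (inr j))).
Proof.
move=> bn; pose prs := [seq p : 'I_n * 'I_n <- enum {: 'I_n * 'I_n} | p.1 < p.2].
apply: (@nf_ext _ _ _ (fun D a =>
  cc_sat (CConj [::] [::] [seq (inr p.1, inr p.2) | p <- prs]) a)).
  apply: nf_base => [/bn n1|_ z /eqP->]; last exact: reach_refl.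
  suff -> : prs = [::] by [].
  apply/eqP; rewrite -[_ == _]negbK -has_filter; apply/hasP => -[[j k] _] /= jk.
  have := leq_trans (ltn_ord k) n1.
  by rewrite ltnS leqn0 => /eqP k0; rewrite k0 in jk.
move=> D a; rewrite /cc_sat /= all_map; apply/injectiveP/allP => [ia [j k]|al j k e].
  rewrite mem_filter /= => /andP[jk _]; apply/eqP => /ia e.
  by rewrite e ltnn in jk.
apply: val_inj; apply/eqP; case: ltngtP => // jk.
  by have := al (j, k); rewrite mem_filter mem_enum /= e eqxx jk => /(_ isT).
by have := al (k, j); rewrite mem_filter mem_enum /= e eqxx jk => /(_ isT).
Qed.

(* At least n values y: n copies of the disjunction with distinct values of y. *)
Lemma nf_count (X : eqType) (x0 : X) (Z : pred X) (rho : rel_on X) n y :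
  (~~ b -> n <= 1) -> (cn -> [/\ 0 < n, Z y & y != x0]) ->
  (forall D (a a' : X -> adom D), a =1 a' -> rho D a = rho D a') ->
  nf x0 Z rho ->
  nf x0 (fun x => Z x && (x != y))
    (fun D a => n <= #|[pred v | rho D [eta a with y |-> v]]|).
Proof.
move=> bn cz ext nr.
pose s (j : 'I_n) (x : X) : X + 'I_n := if x == y then inr j else inl x.
pose Zj (j : 'I_n) (z : X + 'I_n) :=
  match z with inl x => Z x && (x != y) | inr k => k == j end.
have nj j : @nf (X + 'I_n)%type (inl x0) (Zj j) (fun D a => rho D (a \o s j)).
  apply: nf_subst nr _ => /cz[n0 Zy /negbTE yx0]; split.
    by rewrite /s eq_sym yx0.
  case=> [x /andP[Zx /negbTE xy]|k /eqP->]; first by exists x; rewrite // /s xy.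
  by exists y; rewrite // /s eqxx.
have nall := @nf_all (X + 'I_n)%type (inl x0) 'I_n (enum 'I_n) Zj _ (fun j _ => nj j).
have nA := nf_and nall (nf_injective x0 bn).
have := nf_sub (nf_ex (nf_sub nA (Z' := fun z =>
  if z is inl x then Z x && (x != y) else true) _) _).
move=> H; apply: nf_ext; first apply: (H).
- move=> c [x Zx|k _] /=; apply/orP; left; apply/orP; right; apply/hasP.
    (* A free variable other than [y] is linked to [x0] inside any one copy; [0 < n] provides a
       copy. *)
    have [n0 _ _] := cz c.
    by exists (Ordinal n0); rewrite ?mem_enum.
  by exists k; rewrite ?mem_enum /=.
- by [].
- by [].
move=> D a; rewrite leq_card_ffun; apply: eq_existsb => h; rewrite andbC;
  congr (_ && _).
  apply/forallP/allP => [al j _|al j].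
    have := al j; rewrite inE (ext D _ (sumf a h \o s j)) // => x.
    by rewrite /s /=; case: (x == y).
  have := al j; rewrite mem_enum inE (ext D _ [eta a with y |-> h j]) => [|x].
    by apply.
  by rewrite /s /=; case: (x == y).
Qed.

(** All free variables take the value [u], so they are first identified with the single variable
    [tt]. An existential conjunction over [unit + V] is then an instance of [closed_ex]. *)
Lemma nf_closed (X : eqType) (x0 : X) (Z : pred X) (rho : rel_on X) :
  cq_closed b cn -> nf x0 Z rho ->
  (cn -> Z x0) -> K (fun D u => rho D (fun=> u)).
Proof.
move=> cK n Zx0.
suff H r : @nf unit tt predT r -> K (fun D u => r D (fun=> u)).
  have k : @nf unit tt predT (fun D a => rho D (a \o (fun=> tt))).
    by apply: nf_subst n _ => /Zx0 Zx; split=> // -[] _; exists x0.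
  exact: (closed_ext cK (H _ k)).
elim=> {n} [r' V q [gb gc] e|r' e|r' r1 r2 _ k1 _ k2 e].
- have k := @closed_ex _ _ cK (unit + V)%type (inl tt) q gb.
  apply: (closed_ext cK (k _)) => [c z|D u].
    by apply: gc => //; case: z => [[]|].
  rewrite e; apply/existsP/existsP => [[h /andP[/eqP hu sq]]|[h sq]].
    exists [ffun v => h (inr v)]; apply: cc_sat_imp sq.
    by case=> [[]|v] //=; rewrite ?ffunE.
  exists [ffun z => sumf (fun=> u) h z]; rewrite ffunE /= eqxx.
  by apply: cc_sat_imp sq => z; rewrite ffunE.
- by apply: (closed_ext cK (closed_false cK)) => D u; rewrite e.
- by apply: (closed_ext cK (closed_or cK k1 k2)) => D u; rewrite e.
Qed.

Lemma nf_conj (m : nat) (X : Type) (sat : X -> classifier S) (psi : conj S m X) :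
  foldr (fun p P => K (sat p.2) /\ P) True (cunary psi) ->
  (cn -> conj_connected psi) ->
  nf 0 (fun z => z < m.+1)
    (fun D a => conj_sat (fun x => sat x D) (fun i : 'I_m.+1 => a i) psi).
Proof.
move=> ku cp.
have [un unE] : exists un : seq ('I_m.+1 * {c | K c}), forall D (a : 'I_m.+1 -> adom D),
    all (fun p => sval p.2 D (a p.1)) un = all (fun p =>
      sat p.2 D (a p.1)) (cunary psi).
  elim: (cunary psi) ku => [_|p s IH [kp /IH[un unE]]]; first by exists [::].
  by exists ((p.1, exist _ _ kp) :: un) => D a /=; rewrite unE.
have n0 : @nf 'I_m.+1 ord0 predT (fun D a => cc_sat (CConj (catoms psi) un [::]) a).
  apply: nf_base => // /cp/andP[_ /(connected_graphP _ ord0) r] z _; exact: r.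
apply: nf_ext (nf_subst (s := @nat_of_ord m.+1) n0 _) _.
  by move=> _; split=> // y ym; exists (Ordinal ym).
move=> D a; rewrite /conj_sat /cc_sat /= andbT; congr (_ && _).
exact/esym/(unE D (fun i => a i)).
Qed.

(** The assignment reached after quantifying the variables [p], [p + 1], ... in this order. *)
Fixpoint upd (A : Type) (a : nat -> A) (p : nat) (ys : seq A) : nat -> A :=
  if ys is y :: ys' then upd [eta a with p |-> y] p.+1 ys' else a.

Lemma updE (A : Type) (a : nat -> A) p ys x0 i :
  upd a p ys i = if i < p then a i else if i < p + size ys then nth x0 ys (i - p)
    else a i.
Proof.
elim: ys a p => [|y ys IH] a p /=; first by rewrite addn0; case: ifP => // ->.
rewrite IH /= ltnS addSnnS; case: (ltngtP i p) => [||->] //=.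
- by move=> ip; rewrite subnS; case: (i - p) (subn_gt0 p i) => [|k]; rewrite ?ip.
- by rewrite addnS ltnS leq_addr subnn.
Qed.

Lemma eq_upd (A : Type) (a a' : nat -> A) p ys :
  a =1 a' -> upd a p ys =1 upd a' p ys.
Proof.
elim: ys a a' p => [|y ys IH] a a' p e //=.
by apply: IH => i /=; rewrite e.
Qed.

Lemma eq_count_exists (T : finType) ks (P P' : seq T -> bool) :
  P =1 P' -> count_exists ks P = count_exists ks P'.
Proof.
elim: ks P P' => [|k ks IH] P P' e /=; first exact: e.
by congr (_ <= _); apply: eq_card => y; rewrite !inE; apply: IH => ys.
Qed.

(** Each quantifier is an instance of [nf_count] at its own variable, innermost first. As [0 < p],
    the free variable [0] is never bound. *)
Lemma nf_count_exists ks p (rho : rel_on nat) :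
  (~~ b -> all (fun k => k <= 1) ks) -> (cn -> all (fun k => 0 < k) ks) ->
  0 < p ->
  (forall D (a a' : nat -> adom D), a =1 a' -> rho D a = rho D a') ->
  nf 0 (fun z => z < p + size ks) rho ->
  nf 0 (fun z => z < p)
    (fun D a => count_exists ks (fun ys => rho D (upd a p ys))).
Proof.
move=> bk ck p0 ext; elim: ks p p0 bk ck => [|k ks IH] p p0 bk ck.
  by rewrite addn0.
rewrite /= -addSnnS => /IH{}IH.
have {}IH := IH isT (fun h => proj2 (andP (bk h))) (fun h => proj2 (andP (ck h))).
apply: nf_sub (nf_count (n := k) (y := p) _ _ _ IH) _ => [nb|c|D a a' e|_ x xp].
- by case/andP: (bk nb).
- by rewrite -lt0n; case/andP: (ck c).
- by apply: eq_count_exists => ys; apply: ext; apply: eq_upd.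
- by rewrite ltnS ltnW //= neq_ltn xp.
Qed.

End NF.

Section Into.
Variables (b cn : bool).
Hypothesis cK : cq_closed b cn.

Lemma closed_count_exists ks (I : Type) (psis : seq I) (rho : I -> rel_on nat) :
  (~~ b -> all (fun k => k <= 1) ks) -> (cn -> all (fun k => 0 < k) ks) ->
  (forall i D (a a' : nat -> adom D), a =1 a' -> rho i D a = rho i D a') ->
  foldr (fun i P => nf b cn 0 (fun z => z < (size ks).+1) (rho i) /\ P) True psis ->
  K (fun D u => count_exists ks
       (fun ys => has (fun i => rho i D (fun j => nth u (u :: ys) j)) psis)).
Proof.
move=> bk ck ext np.
have n0 := nf_has np.
have n1 : nf b cn 0 (fun z => z < 1) (fun D a => count_exists ks (fun ys =>
  has (fun i => rho i D (upd a 1 ys)) psis)).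
  apply: (@nf_count_exists _ _ ks 1 _ bk ck) n0 => // D a a' e.
  by apply: eq_has => i; apply: ext.
apply: (closed_ext cK (nf_closed cK n1 _)) => // D u.
apply: eq_count_exists => ys; apply: eq_has => i; apply: ext => j.
(* All variables start with the value [u], which is also the default of [nth]; so both assignments
   agree beyond the end of [ys] as well. *)
rewrite (updE _ _ _ u); case: j => [|j] //=; rewrite add1n ltnS subn1 /=.
by case: ltnP => // h; rewrite nth_default.
Qed.

End Into.

(** * GHML and HML inside closed classes *)

Section Translations.

Lemma eq_conj_sat (D : database S) m X (sat : X -> adom D -> bool)
    (a a' : 'I_m.+1 -> adom D) (psi : conj S m X) :
  a =1 a' -> conj_sat sat a psi = conj_sat sat a' psi.
Proof.
move=> e; rewrite /conj_sat; congr (_ && _).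
  by apply: eq_all => f; rewrite (@eq_fact_map _ _ _ _ (val \o a')) // => i /=;
    rewrite e.
by apply: eq_all => p; rewrite e.
Qed.

Lemma closed_ghml cn : cq_closed true cn ->
  forall phi : ghml S, (cn -> ghml_connected phi) -> K (fun D u => ghml_sat phi u).
Proof.
(* The recursion goes through the lists nested in [conj], for which the generated induction
   principle gives no hypothesis; hence [fix], with inner inductions on [psis] and on the unary
   conjuncts. *)
move=> cK; fix IH 1 => phi; case: phi => [phi|phi1 phi2|ks psis] c /=.
- by apply: (closed_neg cK); apply: IH.
- by apply: (closed_or cK); apply: IH => /c/= /andP[].
- apply: (@closed_count_exists _ _ cK ks _ psis (fun psi D a =>
    conj_sat (@ghml_sat S D) (fun i : 'I_(size ks).+1 => a i) psi)) => //.
  + by move=> /c /andP[].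
  + move=> psi D a a' e; by apply: eq_conj_sat => i; apply: e.
  + have {}c : cn -> all (fun psi => conj_connected psi && all (fun p =>
    ghml_connected p.2) (cunary psi)) psis by move=> /c/= /andP[].
    elim: psis c => [|psi psis IHp] c //=; split; last by apply: IHp => /c/= /andP[].
    apply: (@nf_conj _ _ _ _ (fun phi D u => ghml_sat phi u));
      last by move/c => /= /andP[/andP[]].
    case: psi c => at_ /=; elim=> [|[i phi] un IHu] c //=; split.
      by apply: IH => /c /= /andP[/andP[_ /andP[]]].
    apply: IHu => /c /= /andP[/andP[h1 /andP[_ h2]] h3].
    by apply/andP; split=> //; apply/andP; split.
Qed.

Lemma count_exists_nseq1 (T : finType) m (P : seq T -> bool) :
  count_exists (nseq m 1) P = [exists ys : m.-tuple T, P ys].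
Proof.
elim: m P => [|m IH] P /=.
  apply/idP/existsP => [Pn|[ys]]; first by exists [tuple].
  by rewrite tuple0.
apply/card_gt0P/existsP => [[y]|[ys Py]].
  by rewrite inE IH => /existsP[ys Py]; exists [tuple of y :: ys].
exists (thead ys); rewrite inE IH; apply/existsP; exists [tuple of behead ys].
by move: Py; rewrite [ys]tuple_eta.
Qed.

(** An HML quantifier is a chain of quantifiers with threshold 1 over a one-element disjunction, so
    it introduces no inequality. *)
Lemma closed_hml : cq_closed false false ->
  forall phi : hml S, K (fun D u => hml_sat phi u).
Proof.
move=> cK; fix IH 1 => phi; case: phi => [phi|phi1 phi2|m psi] /=.
- by apply: (closed_neg cK); apply: IH.
- by apply: (closed_or cK); apply: IH.
- apply: (closed_ext cK (@closed_count_exists _ _ cK (nseq m 1) _ [:: psi] (fun psi D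
  a =>
    conj_sat (@hml_sat S D) (fun i : 'I_m.+1 => a i) psi) _ _ _ _)) => //.
  + by move=> _; apply/allP => k /nseqP[->].
  + move=> {}psi D a a' e; by apply: eq_conj_sat => i; apply: e.
  + split=> //; rewrite size_nseq.
    apply: (@nf_conj _ _ _ _ (fun phi D u => hml_sat phi u)) => //.
    by case: psi => at_ /=; elim=> [|[i phi] un IHu] //=; split.
  + by move=> D u; rewrite count_exists_nseq1; apply: eq_existsb => ys; rewrite /= orbF.
Qed.

End Translations.
End Closed.

(** * UNFO and HML *)

Section UNFOC.
Local Open Scope fset_scope.
Variable S : schema.

Lemma eq_unfoc_sat (D : database S) (phi : unfoc S) (a a' : nat -> adom D) :
  {in unfoc_fv phi, a =1 a'} -> unfoc_sat phi a = unfoc_sat phi a'.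
Proof.
elim: phi a a' => [f|p1 IH1 p2 IH2|p1 IH1 p2 IH2|n y p IH|p IH] a a' e /=.
- congr (_ \in D); case: f e => R t e; rewrite /fact_map /=; congr existT.
  apply: val_inj => /=; apply/eq_in_map => x xt; congr val; apply: e.
  by rewrite /= inE.
- by congr (_ && _); [apply: IH1|apply: IH2] => x xp; apply: e; rewrite /= inE xp ?orbT.
- by congr (_ || _); [apply: IH1|apply: IH2] => x xp; apply: e; rewrite /= inE xp ?orbT.
- congr (_ <= _); apply: eq_card => v; rewrite !inE; apply: IH => x xp /=.
  by case: eqP => // /eqP xy; apply: e; rewrite /= !inE xy.
- by congr (~~ _); apply: IH.
Qed.

Lemma fset_card_le1 (A : {fset nat}) : #|` A| <= 1 -> exists z, A `<=` [fset z].
Proof.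
rewrite leq_eqVlt => /orP[/cardfs1P[z ->]|]; first by exists z.
by rewrite ltnS leqn0 cardfs_eq0 => /eqP->; exists 0; apply: fsub0set.
Qed.

Lemma unfoc_sat_const (D : database S) (phi : unfoc S) z (a : nat -> adom D) :
  unfoc_fv phi `<=` [fset z] -> unfoc_sat phi a = unfoc_sat phi (fun=> a z).
Proof.
move=> /fsubsetP sub; apply: eq_unfoc_sat => x /sub.
by rewrite inE => /eqP->.
Qed.

(** A negated subformula has at most one free variable [z], so it defines a classifier of [K] and
    comes back as a unary conjunct at [z]. The other connectives are operations on normal forms. *)
Lemma closed_unfoc (K : class S) b : cq_closed K b false ->
  forall phi : unfoc S, unfoc_wf phi -> (~~ b -> is_unfo phi) ->
  nf K b false 0 xpred0 (fun D a => unfoc_sat phi a).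
Proof.
move=> cK; elim=> [f|p1 IH1 p2 IH2|p1 IH1 p2 IH2|n y p IH|p IH] /=.
- move=> _ _; apply: (nf_ext (rho := fun D a => cc_sat (CConj [:: f] [::] [::]) a));
  first exact: nf_base.
  by move=> D a; rewrite /cc_sat /= !andbT.
- case/andP=> w1 w2 bu.
  by apply: nf_sub (nf_and (IH1 w1 _) (IH2 w2 _)) _ => // /bu/andP[].
- case/andP=> w1 w2 bu.
  by apply: nf_or (IH1 w1 _) (IH2 w2 _) _ => // /bu/andP[].
- move=> w bu; apply: nf_sub (nf_count (n := n) (y := y) _ _ _ (IH w _)) _ => //.
  + by move=> /bu/andP[/eqP->].
  + by move=> D a a' e; apply: eq_unfoc_sat => x _.
  + by move=> /bu/andP[].
- case/andP=> w /fset_card_le1[z sub] bu.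
  have k := closed_neg cK (nf_closed cK (IH w bu) (fun h => False_ind _ (notF h))).
  apply: (nf_ext (rho := fun D a => cc_sat (CConj [::] [:: (z, exist _ _ k)] [::]) a)).
    exact: nf_base.
  by move=> D a; rewrite /cc_sat /= !andbT (unfoc_sat_const a sub).
Qed.

(** Bound variables are renamed along with the free ones; for an injective [g] nothing is
    captured. *)
Fixpoint unfoc_ren (g : nat -> nat) (phi : unfoc S) : unfoc S :=
  match phi with
  | UAtom f => UAtom (fact_map g f)
  | UAnd p1 p2 => UAnd (unfoc_ren g p1) (unfoc_ren g p2)
  | UOr p1 p2 => UOr (unfoc_ren g p1) (unfoc_ren g p2)
  | UExists n y p => UExists n (g y) (unfoc_ren g p)
  | UNeg p => UNeg (unfoc_ren g p)
  end.

Section Ren.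
Variable g : nat -> nat.
Hypothesis ig : injective g.

Lemma unfoc_ren_sat (D : database S) (phi : unfoc S) (a : nat -> adom D) :
  unfoc_sat (unfoc_ren g phi) a = unfoc_sat phi (a \o g).
Proof.
elim: phi a => [f|p1 IH1 p2 IH2|p1 IH1 p2 IH2|n y p IH|p IH] a /=.
- by rewrite fact_map_comp.
- by rewrite IH1 IH2.
- by rewrite IH1 IH2.
- congr (_ <= _); apply: eq_card => v; rewrite !inE IH; apply: eq_unfoc_sat => x _ /=.
  by rewrite (inj_eq ig).
- by rewrite IH.
Qed.

Lemma unfoc_ren_fv (phi : unfoc S) : unfoc_fv (unfoc_ren g phi) = g @` unfoc_fv phi.
Proof.
elim: phi => [f|p1 IH1 p2 IH2|p1 IH1 p2 IH2|n y p IH|p IH] //=.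
- apply/fsetP=> x; rewrite !inE /=; apply/mapP/imfsetP => -[/= z zf ->]; exists z => //.
    by rewrite inE.
  by move: zf; rewrite inE.
- by rewrite IH1 IH2 imfsetU.
- by rewrite IH1 IH2 imfsetU.
- rewrite IH; apply/fsetP=> x; rewrite !inE;
  apply/andP/imfsetP => [[xy /imfsetP[/= z zf xz]]|[/= z]].
    exists z => //=; rewrite !inE zf andbT; apply: contra xy => /eqP <-.
    by rewrite xz.
  rewrite !inE => /andP[zy zf] ->; rewrite (inj_eq ig); split=> //.
  by apply/imfsetP; exists z.
Qed.

Lemma unfoc_ren_wf (phi : unfoc S) : unfoc_wf (unfoc_ren g phi) = unfoc_wf phi.
Proof.
elim: phi => [f|p1 IH1 p2 IH2|p1 IH1 p2 IH2|n y p IH|p IH] //=; rewrite ?IH1 ?IH2 //.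
by rewrite IH unfoc_ren_fv card_imfset.
Qed.

Lemma is_unfo_ren (phi : unfoc S) : is_unfo (unfoc_ren g phi) = is_unfo phi.
Proof.
by elim: phi => [f|p1 IH1 p2 IH2|p1 IH1 p2 IH2|n y p IH|p IH] //=;
  rewrite ?IH1 ?IH2 ?IH.
Qed.

End Ren.

(** The transposition of [z] and [x]: it moves a free variable [z] to a prescribed [x] and is
    injective. *)
Definition swap (z x i : nat) := if i == z then x else if i == x then z else i.

Lemma swap_inj z x : injective (swap z x).
Proof.
apply: (can_inj (g := swap z x)) => i; rewrite /swap.
case: (eqVneq i z) => [->|iz]; first by rewrite eqxx; case: eqVneq => // ->.
case: (eqVneq i x) => [->|ix]; first by rewrite eqxx.
by rewrite (negbTE iz) (negbTE ix).
Qed.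

End UNFOC.

(** * HML and UNFO as closed classes *)

Section Expressible.
Variable S : schema.

(** The logics are defined by equality with the classifier of a formula; closing them under
    pointwise equality provides [closed_ext]. *)
Definition expressible (C : class S) : class S :=
  fun c => exists2 c', C c' & forall D v, c D v = c' D v.

Lemma expressible_power (P : database S -> Prop) (C1 C2 : class S) :
  (forall c, C1 c -> exists2 c', expressible C2 c' &
     forall D v, P D -> c D v = c' D v) ->
  at_least_as_expressive_on P C2 C1.
Proof.
move=> sub c /sub[c' [c2 C2c e] e']; exists c2 => // D v PD.
by rewrite e' // e.
Qed.

Section Enum.
Variables (V : finType) (pt : V).

Definition others : seq V := [seq v <- enum V | v != pt].

(** Numbers the vertices with [pt] first, so that an assignment sending [pt] to [u] is a list
    [u :: ys] read at these positions, as in the semantics of quantifiers. *)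
Definition pos (v : V) : nat := index v (pt :: others).

Lemma pos_lt v : pos v < (size others).+1.
Proof.
by rewrite -[(size _).+1]/(size (pt :: others)) index_mem inE mem_filter mem_enum
  andbT; case: eqP.
Qed.

Lemma pos_pt : pos pt = 0.
Proof. by rewrite /pos /= eqxx. Qed.

Lemma nth_pos v : nth pt (pt :: others) (pos v) = v.
Proof. by rewrite nth_index // -index_mem pos_lt. Qed.

Lemma pos_nth i : i < (size others).+1 -> pos (nth pt (pt :: others) i) = i.
Proof.
move=> i_lt; rewrite /pos index_uniq // cons_uniq mem_filter eqxx /=.
by rewrite filter_uniq // enum_uniq.
Qed.

Lemma card_hom_tuple (A : finType) (u : A) (P : (V -> A) -> bool) :
  (forall h h', h =1 h' -> P h = P h') ->
  #|[pred h : {ffun V -> A} | (h pt == u) && P h]| =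
  #|[pred ys : (size others).-tuple A | P (fun v => nth u (u :: ys) (pos v))]|.
Proof.
move=> ext; pose F (ys : (size others).-tuple A) := [ffun v => nth u (u :: ys) (pos v)].
have iF : injective F.
  move=> ys ys' /ffunP e; apply: val_inj; apply: (@eq_from_nth _ u) => [|i].
    by rewrite !size_tuple.
  rewrite size_tuple => i_lt; have := e (nth pt (pt :: others) i.+1).
  by rewrite !ffunE pos_nth.
rewrite -(card_imset _ iF); apply: eq_card => h; rewrite !inE.
apply/andP/imsetP => [[/eqP hu Ph]|[ys Pys ->]].
  have sz : size [seq h v | v <- others] == size others by rewrite size_map.
  have hE : h =1 (fun v => nth u (u :: Tuple sz) (pos v)).
    move=> v /=; rewrite -[in LHS](nth_pos v) -hu.
    by case: (pos v) (pos_lt v) => [|i] //=; rewrite ltnS => i_lt; rewrite (nth_map pt).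
  exists (Tuple sz); first by rewrite inE -(ext h).
  by apply/ffunP => v; rewrite ffunE -hE.
rewrite ffunE pos_pt eqxx; split=> //; move: Pys; rewrite inE.
by rewrite (ext (F ys) (fun v => nth u (u :: ys) (pos v))) // => v; rewrite ffunE.
Qed.

Lemma exists_hom_tuple (A : finType) (u : A) (P : (V -> A) -> bool) :
  (forall h h', h =1 h' -> P h = P h') ->
  [exists h : {ffun V -> A}, (h pt == u) && P h] =
  [exists ys : (size others).-tuple A, P (fun v => nth u (u :: ys) (pos v))].
Proof.
move=> /(card_hom_tuple u) e; apply/idP/idP => /existsP[x Px].
  by apply/existsP; apply/card_gt0P; rewrite -e; apply/card_gt0P; exists x.
by apply/existsP; apply/card_gt0P; rewrite e; apply/card_gt0P; exists x.
Qed.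

End Enum.

Lemma eq_ex_cls (K : class S) (V : finType) (pt : V) (q : cconj K V) D u :
  @ex_cls _ K V pt q D u = [exists ys : (size (others pt)).-tuple (adom D),
    cc_sat q (fun v => nth u (u :: ys) (pos pt v))].
Proof. by apply: exists_hom_tuple => h h'; apply: eq_cc_sat. Qed.

Lemma expressible_uns (F T T' : Type) (C : class S) (sat : F -> classifier S)
    (wf : F -> bool) (g : T -> T') :
  (forall c, C c -> exists2 phi, wf phi & c = sat phi) ->
  forall un : seq (T * {c | expressible C c}),
  exists2 un' : seq (T' * F), all (fun p => wf p.2) un' &
    forall D (a : T' -> adom D),
      all (fun p => sat p.2 D (a p.1)) un' = all (fun p => sval p.2 D (a (g p.1))) un.
Proof.
move=> Cwf; elim=> [|[x [c kc]] un [un' w IH]]; first by exists [::].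
have [c' /Cwf[phi wphi ->] e] := kc.
by exists ((g x, phi) :: un') => [|D a] /=; rewrite ?wphi // e IH.
Qed.

Lemma hml_closed : cq_closed (expressible (HML S)) false false.
Proof.
split.
- by move=> c c' [_ [phi ->] e] e'; exists (fun D v => hml_sat phi v);
  [exists phi|move=> D v; rewrite -e' e].
- exists (fun D v => hml_sat (HExists (Conj (m := 0) [::] [::])) v).
    by eexists; reflexivity.
  by move=> D v /=; apply/esym/existsP; exists [tuple].
- move=> c [_ [phi ->] e]; exists (fun D v => hml_sat (HNeg phi) v);
  first by exists (HNeg phi).
  by move=> D v; rewrite e.
- move=> c c' [_ [phi ->] e] [_ [phi' ->] e'].
  exists (fun D v => hml_sat (HOr phi phi') v); first by exists (HOr phi phi').
  by move=> D v; rewrite e e'.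
- move=> V pt q /(_ isT) nq _; set m := size (others pt).
  pose idx v : 'I_m.+1 := inord (pos pt v).
  have wf c : HML S c -> exists2 phi : hml S, predT phi & c = (fun D v =>
    hml_sat phi v).
    by case=> phi ->; exists phi.
  have [un' _ unE] := expressible_uns idx wf (uns q).
  pose phi := HExists (Conj [seq fact_map idx f | f <- ats q] un').
  exists (fun D v => hml_sat phi v); first by exists phi.
  move=> D u; rewrite eq_ex_cls /=; apply: eq_existsb => ys.
  rewrite /cc_sat nq andbT /conj_sat /= all_map; congr (_ && _).
    apply: eq_all => f /=; rewrite fact_map_comp; congr (_ \in D).
    by apply: eq_fact_map => v /=; rewrite inordK ?pos_lt.
  apply: etrans (esym (unE D (fun i : 'I_m.+1 => nth u (u :: ys) i))).
  by apply: eq_all => p; rewrite inordK ?pos_lt.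
Qed.

Lemma sat_exists_iota (D : database S) (phi : unfoc S) (a : nat -> adom D) p m :
  unfoc_sat (foldr (UExists 1) phi (iota p m)) a =
  count_exists (nseq m 1) (fun ys => unfoc_sat phi (upd a p ys)).
Proof.
elim: m p a => [|m IH] p a //=.
by congr (_ <= _); apply: eq_card => y; rewrite !inE IH.
Qed.

Lemma fv_exists_iota (phi : unfoc S) p m :
  (unfoc_fv phi `<=` [fset x in iota 0 (p + m)])%fset ->
  (unfoc_fv (foldr (UExists 1) phi (iota p m)) `<=` [fset x in iota 0 p])%fset.
Proof.
elim: m p => [|m IH] p; first by rewrite addn0.
rewrite addnS -addSn => /IH /fsubsetP sub; apply/fsubsetP => x /=.
rewrite !inE => /andP[xp /sub]; rewrite !inE !mem_iota !add0n !leq0n /= ltnS.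
case/orP=> [/eqP x0|/andP[_]]; first by rewrite ltn_neqAle xp x0.
by rewrite leq_eqVlt (negbTE xp).
Qed.

Lemma unfo_unary c : UNFO S c -> forall x, exists phi : unfoc S,
  [/\ is_unfo phi, unfoc_wf phi, (unfoc_fv phi `<=` [fset x])%fset
    & forall D (a : nat -> adom D), unfoc_sat phi a = c D (a x)].
Proof.
case=> phi [un wf /fset_card_le1[z sub]] -> x.
have si := @swap_inj z x.
exists (unfoc_ren (swap z x) phi); split.
- by rewrite is_unfo_ren.
- by rewrite unfoc_ren_wf.
- rewrite unfoc_ren_fv //; apply/fsubsetP => y /imfsetP[/= w /(fsubsetP sub)].
  by rewrite !inE => /eqP-> ->; rewrite /swap eqxx.
- move=> D a; rewrite unfoc_ren_sat // (unfoc_sat_const _ sub) /= /swap eqxx.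
  by rewrite /unfoc_accepts.
Qed.

(** Every UNFO formula contains an atom, so a relation symbol is required even to express truth,
    here as [utrue]. The vertices become the variables [pos pt v], of which all but [0] are
    quantified. *)
Lemma unfo_closed : 0 < #|sym S| -> cq_closed (expressible (UNFO S)) false false.
Proof.
move=> /card_gt0P[R0 _].
pose atom0 : unfoc S := UAtom (existT _ R0 [tuple of nseq (ar R0) 0]).
pose utrue := UOr atom0 (UNeg atom0).
have fv0 : (unfoc_fv atom0 `<=` [fset 0])%fset.
  by apply/fsubsetP => x; rewrite !inE /= => /nseqP[->].
have fvt : (unfoc_fv utrue `<=` [fset 0])%fset by rewrite fsubUset fv0.
have card1 (A : {fset nat}) z : (A `<=` [fset z])%fset -> #|` A| <= 1.
  by move=> /fsubset_leq_card; rewrite cardfs1.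
have wft : unfoc_wf utrue by rewrite /= (card1 _ _ fv0).
have satt D (a : nat -> adom D) : unfoc_sat utrue a by rewrite /= orbN.
have mk phi c : is_unfo phi -> unfoc_wf phi -> (unfoc_fv phi `<=` [fset 0])%fset ->
    (forall D v, c D v = unfoc_sat phi (fun=> v)) -> expressible (UNFO S) c.
  move=> u w f e; exists (unfoc_accepts phi) => //.
  by exists phi => //; split=> //; apply: card1 f.
have un c : expressible (UNFO S) c -> forall x, exists phi : unfoc S,
    [/\ is_unfo phi, unfoc_wf phi, (unfoc_fv phi `<=` [fset x])%fset
    & forall D (a : nat -> adom D), unfoc_sat phi a = c D (a x)].
  case=> c' /unfo_unary h e x; have [phi [h1 h2 h3 h4]] := h x.
  by exists phi; split=> // D a; rewrite h4 e.
split.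
- by move=> c c' [c2 h e] e'; exists c2 => // D v; rewrite -e' e.
- by apply: (mk utrue) => // D v; rewrite satt.
- move=> c /un/(_ 0)[phi [h1 h2 h3 h4]]; apply: (mk (UNeg phi)) => //=.
    by rewrite h2 (card1 _ _ h3).
  by move=> D v; rewrite h4.
- move=> c c' /un/(_ 0)[phi [h1 h2 h3 h4]] /un/(_ 0)[phi' [h1' h2' h3' h4']].
  apply: (mk (UOr phi phi')) => //=; rewrite ?h1 ?h2 // ?fsubUset ?h3 //.
  by move=> D v; rewrite h4 h4'.
- move=> V pt q /(_ isT) nq _; set m := size (others pt).
  have [phi [h1 h2 h3 h4]] : exists phi : unfoc S,
    [/\ is_unfo phi, unfoc_wf phi, (unfoc_fv phi `<=` [fset x in iota 0 m.+1])%fset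
    & forall D (a : nat -> adom D), unfoc_sat phi a = cc_sat q (a \o pos pt)].
    have pos_in v : pos pt v \in iota 0 m.+1 by rewrite mem_iota add0n pos_lt.
    rewrite /cc_sat nq; elim: (ats q) => [|f s [phi [h1 h2 h3 h4]]].
      elim: (uns q) => [|[v [c kc]] s [phi [h1 h2 h3 h4]]].
        exists utrue; split=> //.
        by apply: (fsubset_trans fvt); rewrite fsub1set inE.
      have [phi' [h1' h2' h3' h4']] := un _ kc (pos pt v).
      exists (UAnd phi' phi); split=> //=; rewrite ?h1 ?h2 ?h1' ?h2' //.
        rewrite fsubUset h3 andbT; apply: (fsubset_trans h3').
        by rewrite fsub1set; have := pos_in v; rewrite !inE.
      by move=> D a; rewrite h4 h4' /= !andbT.
    exists (UAnd (UAtom (fact_map (pos pt) f)) phi); split=> //=.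
      rewrite fsubUset h3 andbT; apply/fsubsetP => x; rewrite inE.
      by case/mapP=> v _ ->; have := pos_in v; rewrite !inE.
    by move=> D a; rewrite h4 -andbA fact_map_comp.
  apply: (mk (foldr (UExists 1) phi (iota 1 m))).
  + by elim: (iota 1 m) => [|i s] //=.
  + by elim: (iota 1 m) => [|i s] //=.
  + apply: (fsubset_trans (fv_exists_iota _)) => //.
    by apply/fsubsetP => x; rewrite !inE ?orbF.
  + move=> D u; rewrite sat_exists_iota count_exists_nseq1 eq_ex_cls.
    apply: eq_existsb => ys; rewrite h4; apply: eq_cc_sat => v /=.
    rewrite (updE _ _ _ u); case: (pos pt v) (pos_lt pt v) => [|i] //= i_lt.
    by rewrite add1n size_tuple i_lt subn1.
Qed.

End Expressible.

(** * Connected GHML *)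

Section ConnectedGHML.
Variable S : schema.
Local Notation K := (expressible (connected_GHML S)).

(** The empty disjunction is false and vacuously connected; its negation serves as truth. *)
Lemma cghml_true : K (fun _ _ => true).
Proof.
exists (fun D v => ghml_sat (GNeg (GExists (ks := [::]) [::])) v) => //.
by exists (GNeg (GExists (ks := [::]) [::])).
Qed.

Lemma cghml_or c c' : K c -> K c' -> K (fun D v => c D v || c' D v).
Proof.
move=> [_ [phi cphi ->] e] [_ [phi' cphi' ->] e'].
exists (fun D v => ghml_sat (GOr phi phi') v) => [|D v]; last by rewrite e e'.
by exists (GOr phi phi'); rewrite //= cphi.
Qed.

Lemma cghml_neg c : K c -> K (fun D v => ~~ c D v).
Proof.
move=> [_ [phi cphi ->] e].
exists (fun D v => ghml_sat (GNeg phi) v) => [|D v]; last by rewrite e.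
by exists (GNeg phi).
Qed.

Lemma expressible_ext (C : class S) c c' : expressible C c ->
  (forall D v, c D v = c' D v) -> expressible C c'.
Proof. by case=> c2 Cc e e'; exists c2 => // D v; rewrite -e' e. Qed.

(** Numbering the vertices by [pos] turns [q] into the body of a formula; the third hypothesis
    yields the atom using [x] that [conj_connected] asks for. *)
Lemma cghml_count_atom (V : finType) (pt : V) (q : cconj K V) ks :
  nqs q = [::] -> (forall v, reach (gaifman (ats q)) pt v) ->
  has (fun f => pt \in fargs f) (ats q) ->
  size ks = size (others pt) -> all (fun k => 0 < k) ks ->
  K (fun D u => count_exists ks
       (fun ys => cc_sat q (fun v => nth u (u :: ys) (pos pt v)))).
Proof.
move=> nq rq hq sk k0; set m := size ks.
pose idx v : 'I_m.+1 := inord (pos pt v).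
have idxE v : idx v = pos pt v :> nat by rewrite inordK // /m sk pos_lt.
have idx_pt : idx pt = ord0 by apply: val_inj; rewrite /= idxE pos_pt.
have wf c : connected_GHML S c -> exists2 phi :
  ghml S, ghml_connected phi & c = (fun D v => ghml_sat phi v).
  by [].
have [un' wun unE] := expressible_uns idx wf (uns q).
pose psi := Conj [seq fact_map idx f | f <- ats q] un'.
exists (fun D v => ghml_sat (GExists [:: psi]) v).
  exists (GExists [:: psi]) => //=; rewrite k0 wun !andbT /=.
  apply/andP; split.
    rewrite has_map; case/hasP: hq => f fq pf; apply/hasP; exists f => //=.
    by rewrite -idx_pt fargs_map map_f.
  apply/(connected_graphP _ ord0) => i.
  have -> : i = idx (nth pt (pt :: others pt) i).
    by apply: val_inj; rewrite /= idxE pos_nth // -sk.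
  by rewrite -idx_pt; apply: reach_gaifman_map.
move=> D u; apply: eq_count_exists => ys.
rewrite /= orbF /cc_sat nq andbT /conj_sat /= all_map; congr (_ && _).
  apply: eq_all => f /=; rewrite fact_map_comp; congr (_ \in D).
  by apply: eq_fact_map => v /=; rewrite idxE.
apply: etrans (esym (unE D (fun i : 'I_m.+1 => nth u (u :: ys) i))).
by apply: eq_all => p; rewrite idxE.
Qed.

Lemma cghml_has (I : Type) (s : seq I) (c : I -> classifier S) :
  (forall i, K (c i)) -> K (fun D v => has (fun i => c i D v) s).
Proof.
move=> kc; elim: s => [|i s IH].
  by apply: expressible_ext (cghml_neg cghml_true) _.
exact: expressible_ext (cghml_or (kc i) IH) _.
Qed.

(** A nonempty path from [pt] begins with an edge, and an edge comes from an atom containing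
    [pt]. *)
Lemma no_atom_singleton (V : finType) (pt : V) (A : seq (fact S V)) :
  (forall v, reach (gaifman A) pt v) -> ~~ has (fun f => pt \in fargs f) A ->
  forall v, v = pt.
Proof.
move=> r /hasP na v; case: (r v) => -[|z p] //=.
by case/andP=> /andP[_ /hasP[f fA /andP[pf _]]]; case: na; exists f.
Qed.

Lemma adomP (D : database S) (u : nat) :
  reflect (exists2 f, f \in D & u \in fargs f) (u \in adom D).
Proof.
apply: (iffP (bigfcupP _ _ _ _)) => [[f /andP[fD _]]|[f fD uf]].
  by rewrite !inE; exists f.
by exists f; rewrite ?fD // inE.
Qed.

(* A pattern whose point occurs in no atom is a single vertex: as the value of
   the point is in the active domain, an atom can be guessed there. *)
Lemma cghml_count (V : finType) (pt : V) (q : cconj K V) ks :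
  nqs q = [::] -> (forall v, reach (gaifman (ats q)) pt v) ->
  size ks = size (others pt) -> all (fun k => 0 < k) ks ->
  K (fun D u => count_exists ks
       (fun ys => cc_sat q (fun v => nth u (u :: ys) (pos pt v)))).
Proof.
move=> nq rq sk k0.
have [hq|nhq] := boolP (has (fun f => pt \in fargs f) (ats q)).
  exact: cghml_count_atom.
have Vpt := no_atom_singleton rq nhq.
have oth : others pt = [::].
  apply/eqP; rewrite -[_ == _]negbK -has_filter; apply/hasP => -[v _ /=].
  by rewrite (Vpt v) eqxx.
move: sk; rewrite oth => /size0nil -> {ks k0} /=.
(* A guess is a symbol together with one of its positions. Its atom has pairwise distinct variables,
   and all of [q] is moved to the variable at that position. *)
pose I : finType := {R : sym S & 'I_(ar R)}.
pose q' (i : I) : cconj K 'I_(ar (tag i)) :=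
  cc_cat (CConj [:: existT _ (tag i) (ord_tuple _)] [::] [::])
         (cc_map (fun=> tagged i) q).
pose c (i : I) : classifier S := fun D u => ex_cls (tagged i) (q' i) u.
have kc i : K (c i).
  have nq' : nqs (q' i) = [::] by rewrite /= nq.
  have rq' v : reach (gaifman (ats (q' i))) (tagged i) v.
    case: (eqVneq (tagged i) v) => [->|iv]; first exact: reach_refl.
    exists [:: v] => //=; rewrite andbT /gaifman iv /=.
    by rewrite /fargs /= !mem_enum.
  have hq' : has (fun f => tagged i \in fargs f) (ats (q' i)).
    by rewrite /= /fargs /= mem_enum.
  apply: expressible_ext (cghml_count_atom (ks := nseq (size (others (tagged i))) 1)
    nq' rq' hq' _ _) _.
  - by rewrite size_nseq.
  - by apply/allP => k /nseqP[->].
  - by move=> D u; rewrite count_exists_nseq1 /c eq_ex_cls.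
apply: expressible_ext (cghml_has (enum I) kc) _ => D u.
apply/hasP/idP => [[i _]|sq].
  rewrite /c /ex_cls /q' => /existsP[h /andP[/eqP hu]];
    rewrite cc_sat_cat cc_sat_map => /andP[_].
  by apply: cc_sat_imp => v /=; rewrite hu (Vpt v) pos_pt.
(* Conversely, a fact in which [u] occurs supplies the symbol, the position and the values of the
   other variables. *)
have /adomP[[R t] fD ut] := valP u.
have [j tj] := tnthP _ _ ut.
exists (existT _ R j); first by rewrite mem_enum.
have ht (k : 'I_(ar R)) : tnth t k \in adom D.
  by apply/adomP; exists (existT _ R t) => //; apply: mem_tnth.
apply/existsP; exists [ffun k => [` ht k]%fset].
have hj : [ffun k => [` ht k]%fset] j = u by apply: val_inj; rewrite ffunE.
rewrite hj eqxx /= cc_sat_cat cc_sat_map; apply/andP; split.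
  rewrite /cc_sat /= !andbT; congr (_ \in D): (fD); congr existT.
  apply: eq_from_tnth => k; rewrite tnth_map /= ffunE /=.
  by rewrite tnth_ord_tuple.
by apply: cc_sat_imp sq => v /=; rewrite hj (Vpt v) pos_pt.
Qed.

Lemma cghml_closed : cq_closed K false true.
Proof.
split; [exact: expressible_ext|exact: cghml_true|exact: cghml_neg|exact: cghml_or|].
move=> V pt q /(_ isT) nq /(_ isT) rq.
apply: expressible_ext (cghml_count (ks := nseq (size (others pt)) 1) nq rq _ _) _.
- by rewrite size_nseq.
- by apply/allP => k /nseqP[->].
- by move=> D u; rewrite count_exists_nseq1 eq_ex_cls.
Qed.

End ConnectedGHML.

(** * Counting homomorphisms in bounded degree *)

Section Thresholds.
Variable T : finType.

Lemma card_tuple0 (P : seq T -> bool) :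
  #|[pred ys : 0.-tuple T | P ys]| = P [::].
Proof.
case Pn: (P [::]); last by apply: eq_card0 => ys; rewrite inE tuple0.
rewrite (eq_card (B := predT)); last by move=> ys; rewrite inE tuple0 /= Pn.
by rewrite card_tuple expn0.
Qed.

Lemma card_tupleS m (P : seq T -> bool) :
  #|[pred ys : m.+1.-tuple T | P ys]| =
  \sum_y #|[pred ys : m.-tuple T | P (y :: ys)]|.
Proof.
rewrite -sum1_card.
under [RHS]eq_bigr do rewrite -sum1_card.
rewrite pair_big_dep /= (reindex (fun p : T * m.-tuple T => [tuple of p.1 :: p.2])) /=.
  by apply: eq_bigl => -[y ys].
exists (fun ys => (thead ys, [tuple of behead ys])) => [[y ys] _|ys _] /=.
  by congr (_, _); apply: val_inj.
by rewrite [RHS]tuple_eta; apply: val_inj.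
Qed.
End Thresholds.

Lemma card_ord_lt L n : n <= L -> #|[pred k : 'I_L | k < n]| = n.
Proof.
move=> le; have inj : injective (widen_ord le).
  by move=> j k /(congr1 val) /= e; apply: val_inj.
rewrite -[RHS]card_ord -(card_imset _ inj); apply: eq_card => k.
rewrite inE; apply/idP/imsetP => [kn|[j _ ->] /=]; last exact: ltn_ord.
by exists (Ordinal kn) => //; apply: val_inj.
Qed.

(** The level [k] of ['I_L] stands for the threshold [k + 1], so thresholds are positive and at most
    [L]. *)
Definition succs L (ks : seq 'I_L) : seq nat := [seq (nat_of_ord k).+1 | k <- ks].

(* Summing the layer-cake formula  n = #{k | k < n}  over all levels. *)
Lemma card_thresholds (T : finType) L m (P : seq T -> bool) :
  #|[pred ys : m.-tuple T | P ys]| <= L ->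
  #|[pred ys : m.-tuple T | P ys]| =
  #|[pred ks : m.-tuple 'I_L | count_exists (succs ks) P]|.
Proof.
elim: m P => [|m IH] P.
  by rewrite card_tuple0 (card_tuple0 (fun ks : seq 'I_L => count_exists (succs ks) P)).
rewrite card_tupleS => le.
have leN y : #|[pred ys : m.-tuple T | P (y :: ys)]| <= L.
  by apply: leq_trans le; rewrite (bigD1 y) //= leq_addr.
pose Q y (ks : m.-tuple 'I_L) :=
  count_exists (succs ks) (fun ys => P (y :: ys)).
have NE y : #|[pred ys : m.-tuple T | P (y :: ys)]| = \sum_ks Q y ks.
  by rewrite (IH (fun ys => P (y :: ys)) (leN y)) -sum1_card big_mkcond.
(* Each such [y] begins at least one tuple satisfying [P], so [L] levels are enough for these counts
   too. *)
have leC ks : #|[pred y | Q y ks]| <= L.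
  apply: leq_trans le; rewrite -sum1_card big_mkcond /=; apply: leq_sum => y _.
  by rewrite NE (bigD1 ks) //= inE; case: (Q y ks).
rewrite (eq_bigr _ (fun y _ => NE y)) exchange_big /=.
rewrite (card_tupleS m (fun ks : seq 'I_L => count_exists (succs ks) P)).
(* For fixed [ks], the number of [y] satisfying [Q y ks] is the number of levels [k] below it, and
   being above level [k] is reaching the threshold [k + 1]. *)
transitivity (\sum_(ks : m.-tuple 'I_L) \sum_(k : 'I_L) (k < #|[pred y | Q y ks]|)).
  apply: eq_bigr => ks _; rewrite -[RHS]big_mkcond sum1_card card_ord_lt //.
  by rewrite -sum1_card [RHS]big_mkcond; apply: eq_bigr => y _; rewrite inE;
    case: (Q y ks).
rewrite exchange_big /=; apply: eq_bigr => k _.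
by rewrite -big_mkcond sum1_card; apply: eq_card => ks; rewrite !inE.
Qed.

(** * Balls in the Gaifman graph of a database *)

Section Ball.
Variables (S : schema) (D : database S).

Definition max_ar := \max_(R : sym S) ar R.

(** Only a bound on the size is wanted, so repetitions are kept. Including [u] itself makes the
    balls grow with their radius. *)
Definition nbs (u : nat) : seq nat :=
  u :: flatten [seq fargs f | f <- D & u \in fargs f].

Fixpoint ball (n : nat) (u : nat) : seq nat :=
  if n is n'.+1 then flatten [seq ball n' z | z <- nbs u] else [:: u].

Lemma size_flatten_leq (T : Type) (ss : seq (seq T)) n :
  all (fun s => size s <= n) ss -> size (flatten ss) <= size ss * n.
Proof.
elim: ss => [|s ss IH] //= /andP[sn /IH h].
by rewrite size_cat mulSn leq_add.
Qed.

Lemma facts_at_le_degree u : size [seq f <- D | u \in fargs f] <= degree D.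
Proof.
have [uD|uD] := boolP (u \in adom D).
  apply: leq_trans (leq_bigmax (F := fun v : adom D =>
    #|` [fset f in D | val v \in fargs f]%fset|) [` uD]%fset).
  apply: uniq_leq_size; first exact: filter_uniq (fset_uniq D).
  move=> f; rewrite mem_filter => /andP[uf fD].
  have : f \in [fset f in D | u \in fargs f]%fset by rewrite !inE fD.
  by [].
rewrite (eq_in_filter (a2 := pred0)) ?filter_pred0 // => f fD /=.
by apply: contraNF uD => uf; apply/adomP; exists f.
Qed.

Lemma size_nbs u : size (nbs u) <= (degree D * max_ar).+1.
Proof.
rewrite /= ltnS; apply: leq_trans (size_flatten_leq (n := max_ar) _) _.
  apply/allP => _ /mapP[f _ ->]; rewrite size_tuple.
  exact: (leq_bigmax (F := fun R : sym S => ar R)).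
by rewrite size_map leq_mul2r facts_at_le_degree orbT.
Qed.

Lemma size_ball n u : size (ball n u) <= (degree D * max_ar).+1 ^ n.
Proof.
elim: n u => [|n IH] u //.
rewrite /ball -/ball expnS;
  apply: leq_trans (size_flatten_leq (n := (degree D * max_ar).+1 ^ n) _) _.
  by apply/allP => _ /mapP[z _ ->].
by rewrite size_map leq_mul2r size_nbs orbT.
Qed.

Lemma mem_ballS n u z w : z \in nbs u -> w \in ball n z -> w \in ball n.+1 u.
Proof. by move=> zu wz; apply/flattenP; exists (ball n z); rewrite ?map_f. Qed.

Lemma ball_path (V : finType) (A : seq (fact S V)) (h : V -> adom D) n x p :
  all (fun f => fact_map (val \o h) f \in D) A ->
  path (gaifman A) x p -> size p <= n -> val (h (last x p)) \in ball n (val (h x)).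
Proof.
move=> /allP hA; elim: n x p => [|n IH] x p.
  by case: p => //= _ _; rewrite inE.
case: p => [_ _|y p].
  by apply: (@mem_ballS _ _ (val (h x))); [rewrite inE eqxx|apply: (IH x [::])].
case/andP=> /andP[_ /hasP[f fA /andP[xf yf]]] py pn.
apply: (@mem_ballS _ _ (val (h y))); last exact: IH.
rewrite inE; apply/orP; right.
apply/flattenP; exists (fargs (fact_map (val \o h) f));
  last by rewrite fargs_map (map_f (val \o h)).
by rewrite map_f // mem_filter hA // fargs_map (map_f (val \o h)).
Qed.

(** Each vertex is reached from [pt] by a simple path, hence by fewer than [#|V|] edges. So
    homomorphisms map into the ball of radius [#|V|] around [u], whose size is bounded in terms of
    the degree. *)
Lemma card_hom_le (V : finType) (A : seq (fact S V)) (pt : V) (u : adom D) B :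
  (forall v, reach (gaifman A) pt v) -> degree D <= B ->
  #|[pred h : {ffun V -> adom D} | (h pt == u) &&
       all (fun f => fact_map (val \o h) f \in D) A]|
    <= ((B * max_ar).+1 ^ #|V|) ^ #|V|.
Proof.
move=> rA dB; pose bl := [pred x : adom D | val x \in ball #|V| (val u)].
have le1 : #|bl| <= (B * max_ar).+1 ^ #|V|.
  apply: (@leq_trans (size (ball #|V| (val u)))).
    rewrite cardE -(size_map val); apply: uniq_leq_size.
      by rewrite map_inj_uniq ?enum_uniq //; apply: val_inj.
    by move=> _ /mapP[x + ->]; rewrite mem_enum.
  by apply: leq_trans (size_ball _ _) _;
    rewrite leq_exp2r ?ltnS ?leq_mul2r ?dB ?orbT //; apply/card_gt0P; exists pt.
apply: (@leq_trans (#|bl| ^ #|V|)); last first.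
  by case: #|V| le1 => [|n] le1; rewrite ?expn0 // leq_exp2r.
rewrite -card_ffun_on; apply: subset_leq_card; apply/subsetP => h.
rewrite inE => /andP[/eqP hu hA]; apply/ffun_onP => v; rewrite inE -hu.
have [p pp <-] := rA v; case/shortenP: pp => p' pp' up' _.
apply: ball_path hA pp' _; apply: ltnW.
by rewrite -[_.+1]/(size (pt :: p')) -(card_uniqP up') max_card.
Qed.

End Ball.

(** * From networks to formulas *)

Import Order.TTheory GRing.Theory Num.Theory.

Section Determined.
Variables (S : schema) (K : class S) (P : database S -> Prop).

(** Finitely many classifiers and a decoding of their truth values. A function of this form takes
    finitely many values, which is what remains of a real-valued embedding on the side of the
    logic. *)
Record det_data (X : Type) := DetData {
  dI : finType;
  dcl : dI -> classifier S;
  dval : {ffun dI -> bool} -> X }.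

Arguments dcl [X] d i.
Arguments dval [X] d b.

Definition bits X (dd : det_data X) (D : database S) (u : adom D) :
  {ffun dI dd -> bool} :=
  [ffun i => dcl dd i D u].

Definition determined X (f : forall D : database S, adom D -> X) : Prop :=
  exists dd : det_data X, (forall i : dI dd, K (dcl dd i)) /\
    forall D u, P D -> f D u = dval dd (bits dd u).

Lemma det_ext X (f f' : forall D : database S, adom D -> X) :
  determined f -> (forall D u, P D -> f' D u = f D u) -> determined f'.
Proof. by case=> dd [k e] e'; exists dd; split=> // D u PD; rewrite e' ?e. Qed.

Lemma det_cls (c : classifier S) : K c -> determined c.
Proof.
move=> kc; exists (@DetData _ unit (fun=> c) (fun b => b tt)); split=> // D u _.
by rewrite /= ffunE.
Qed.

(** The classifiers of all members are pooled, indexed by the dependent sum of their index types. *)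
Lemma det_family (J : finType) (X : J -> Type) (Y : Type)
    (f : forall j, forall D : database S, adom D -> X j) (h : (forall j, X j) -> Y) :
  (forall j, determined (f j)) -> determined (fun D u => h (fun j => f j D u)).
Proof.
case/fin_all_exists=> dd ddP.
exists (@DetData _ {j : J & dI (dd j)} (fun i => dcl (dd (tag i)) (tagged i))
  (fun b => h (fun j => dval (dd j) [ffun i => b (Tagged (fun j => dI (dd j)) i)]))).
split=> [i|D u PD]; first by case: (ddP (tag i)) => k _; apply: k.
congr h; apply: functional_extensionality_dep => j.
rewrite (proj2 (ddP j)) //; congr dval; apply/ffunP => i.
by rewrite !ffunE.
Qed.

Lemma det_comp X Y (f : forall D : database S, adom D -> X) (h : X -> Y) :
  determined f -> determined (fun D u => h (f D u)).
Proof. by case=> dd [k e]; exists (DetData (dcl dd) (fun b => h (dval dd b)));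
  split=> // D u /e ->. Qed.

Lemma det_const X (x : X) : determined (fun _ _ => x).
Proof. by exists (@DetData _ void (fun i => match i with end) (fun=> x));
  split=> // -[]. Qed.

(** Disjunctive normal form: the disjunction, over the bit vectors decoded as true, of the
    conjunction fixing all bits. *)
Lemma det_bool b cn (c : classifier S) : cq_closed K b cn -> determined c ->
  exists2 c', K c' & forall D v, P D -> c D v = c' D v.
Proof.
move=> cK [dd [k e]].
exists (fun D u => [exists x :
  {ffun dI dd -> bool}, [forall i, dcl dd i D u == x i] && dval dd x]).
  apply: (closed_exists cK) => x.
  case gx: (dval dd x).
    apply: (closed_ext cK (closed_forall cK (fun i => closed_if cK (x i) (k i)))).
    by move=> D u; rewrite andbT.
  by apply: (closed_ext cK (closed_false cK)) => D u; rewrite andbF.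
move=> D u PD; rewrite e //; apply/idP/existsP => [g|[x /andP[/forallP ex gx]]].
  by exists (bits dd u); rewrite g andbT; apply/forallP => i; rewrite ffunE.
by rewrite (_ : bits dd u = x) //; apply/ffunP => i; rewrite ffunE; apply/eqP.
Qed.

End Determined.

Arguments dcl [S X] d i.
Arguments dval [S X] d b.

Section PatternAtoms.
Variables (S : schema) (F : pattern S).

(** The facts of [F] over the finite type of its vertices, the form in which conjunctive queries
    take atoms. *)
Definition patoms : seq (fact S (padom F)) :=
  [seq f <- enum {: {R : sym S & (ar R).-tuple (padom F)}} | fact_map val f \in
    pfacts F].

Lemma patoms_sat (D : database S) (h : padom F -> adom D) :
  [forall f : {R : sym S & (ar R).-tuple (padom F)},
    (fact_map val f \in pfacts F) ==> (fact_map (val \o h) f \in D)] =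
  all (fun f => fact_map (val \o h) f \in D) patoms.
Proof.
rewrite all_filter; apply/forallP/allP => al f; first by move=> _; apply: al.
by apply: al; rewrite mem_enum.
Qed.

Lemma mem_patoms f : f \in pfacts F ->
  exists2 f' : fact S (padom F), f' \in patoms & fact_map val f' = f.
Proof.
case: f => R t fF.
have ht i : tnth t i \in padom F.
  apply: (fsubsetP (padomP F)); apply/adomP; exists (existT _ R t) => //.
  exact: mem_tnth.
have e : fact_map val (existT _ R [tuple [` ht i]%fset | i < ar R] :
  fact S (padom F)) = existT _ R t.
  rewrite /fact_map /=; congr existT; apply: eq_from_tnth => i.
  by rewrite tnth_map tnth_mktuple.
exists (existT _ R [tuple [` ht i]%fset | i < ar R]) => //.
by rewrite mem_filter mem_enum e fF.
Qed.

Lemma connected_patoms v w : connected_pattern F -> reach (gaifman patoms) v w.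
Proof.
move/forallP/(_ v)/forallP/(_ w)/reachP; apply: (@reach_map _ _ _ _ id) => x y.
case/andP=> xy /hasP[f /mem_patoms[f' fA <-] /andP[xf yf]]; apply/orP; right.
apply/andP; split; first by apply: contra xy => /eqP->.
apply/hasP; exists f' => //.
by rewrite fargs_map !mem_map in xf yf; rewrite ?xf //; apply: val_inj.
Qed.

End PatternAtoms.

(** * Sum and maximum of the multiset of a list *)

Section Aggregation.
Variable R : realType.

Lemma sum_agg_seq (s : seq R) : sum_agg (seq_mset s) = (\sum_(x <- s) x)%R.
Proof. by rewrite /sum_agg; apply: perm_big; apply: perm_eq_seq_mset. Qed.

Lemma max_agg_seqP (s : seq R) : s != [::] ->
  max_agg (seq_mset s) \in s /\ forall x, x \in s -> (x <= max_agg (seq_mset s))%R.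
Proof.
move=> s0; have ms : enum_mset (seq_mset s) =i s by apply: perm_mem;
  apply: perm_eq_seq_mset.
have sz : size (enum_mset (seq_mset s)) = size s by apply: perm_size;
  apply: perm_eq_seq_mset.
rewrite /max_agg; case: (enum_mset _) ms sz => [|x t] ms sz.
  by move: sz s0; case: (s).
rewrite -ms; have -> : (forall y, y \in s -> (y <= \big[Num.max/x]_(y <- t) y)%R) <->
    forall y, y \in x :: t -> (y <= \big[Num.max/x]_(y <- t) y)%R.
  by split=> h y ys; apply: h; rewrite ?ms // -ms.
elim: t {ms sz} => [|y t [IH1 IH2]].
  by rewrite big_nil inE eqxx; split=> // y; rewrite inE => /eqP->.
rewrite big_cons; split.
  move: IH1; case: leP => _; rewrite !inE ?eqxx ?orbT // => /orP[->|->] //.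
  by rewrite !orbT.
move=> z; rewrite !inE => /or3P[/eqP->|/eqP->|zt]; rewrite le_max ?lexx //.
  by rewrite IH2 ?orbT ?mem_head.
by rewrite IH2 ?orbT // inE zt orbT.
Qed.

(** The maximum ignores multiplicities, so a max query depends only on which types of homomorphisms
    exist. *)
Lemma eq_mem_max_agg (s s' : seq R) : s =i s' ->
  max_agg (seq_mset s) = max_agg (seq_mset s').
Proof.
move=> e; have [s0|s0] := eqVneq s [::].
  have -> : s' = [::] by case: s' e => // x s' /(_ x); rewrite s0 mem_head.
  by rewrite s0.
have s0' : s' != [::] by apply: contra s0 => /eqP s'0; case: (s) e => // x t /(_ x);
  rewrite s'0 mem_head.
have [i1 l1] := max_agg_seqP s0; have [i2 l2] := max_agg_seqP s0'.
by apply/eqP; rewrite eq_le l2 -?e // l1 ?e.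
Qed.

End Aggregation.

(** * Query results from the types of homomorphisms *)

Section QueryCounts.
Variables (R : realType) (S : schema) (K : class S) (P : database S -> Prop).
Variables (b cn : bool).
Hypothesis cK : cq_closed K b cn.
Variables (d : nat) (dd : det_data S 'rV[R]_d).
Hypothesis kdd : forall i : dI dd, K (dcl dd i).
Variable q : query R S d.

Local Notation F := (qpat q).
Local Notation ty := {ffun padom F -> {ffun dI dd -> bool}}.

(** The common contribution of all homomorphisms of type [t], since [t v] determines the embedding
    at the image of [v]. *)
Definition ty_val (t : ty) (j : 'I_(qdim q)) : R :=
  (\prod_(v : padom F) qtrans q v (dval dd (t v)) ord0 j)%R.

Definition ty_cls (x : {ffun dI dd -> bool}) : classifier S :=
  fun D u => [forall i, dcl dd i D u == x i].

Lemma ty_clsP x : K (ty_cls x).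
Proof. by apply: (closed_forall cK) => i; apply: (closed_if cK). Qed.

Definition ty_conj (t : ty) : cconj K (padom F) :=
  CConj (patoms F) [seq (v, exist _ _ (ty_clsP (t v))) | v <- enum {: padom F}] [::].

Definition ty_of (D : database S) (h : padom F -> adom D) : ty :=
  [ffun v => bits dd (h v)].

Lemma ty_conjP (D : database S) (u : adom D) t (h : {ffun padom F -> adom D}) :
  (h (qpoint q) == u) && cc_sat (ty_conj t) h =
  (h \in Defs.Hom (qpoint q) u) && (ty_of h == t).
Proof.
rewrite inE /is_hom patoms_sat -andbA; congr (_ && _); rewrite /cc_sat /= andbT;
  congr (_ && _).
rewrite all_map; apply/allP/eqP => [al|<- v _ /=].
  apply/ffunP => v; rewrite ffunE; apply/ffunP => i; rewrite ffunE.
  have /al/= := mem_enum {: padom F} v.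
  by move/forallP/(_ i)/eqP.
by apply/forallP => i; rewrite !ffunE.
Qed.

Definition ty_count (t : ty) (D : database S) (u : adom D) : nat :=
  #|[pred h : {ffun padom F -> adom D} | (h (qpoint q) == u) && cc_sat (ty_conj t) h]|.

Variable lam : forall D : database S, adom D -> 'rV[R]_d.
Hypothesis lamE : forall D (u : adom D), P D -> lam u = dval dd (bits dd u).

Lemma prod_ty_val (D : database S) (h : padom F -> adom D) j : P D ->
  (\prod_(v : padom F) qtrans q v (lam (h v)) ord0 j)%R = ty_val (ty_of h) j.
Proof. by move=> PD; apply: eq_bigr => v _; rewrite ffunE lamE. Qed.

Lemma query_eval_sum (D : database S) (u : adom D) : P D -> qagg q = @sum_agg R ->
  query_eval q (@lam D) u = (\row_j \sum_t ty_val t j *+ ty_count t u)%R.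
Proof.
move=> PD qs; apply/rowP => j; rewrite !mxE qs sum_agg_seq big_map big_enum /=.
rewrite (partition_big (fun h : {ffun padom F -> adom D} => ty_of h) predT) //=;
  apply: eq_bigr => t _.
rewrite (eq_bigr (fun=> ty_val t j)); last first.
  by move=> h /andP[_ /eqP <-]; rewrite prod_ty_val.
rewrite sumr_const; congr (_ *+ _)%R; apply: eq_card => h.
by rewrite [RHS]inE ty_conjP.
Qed.

Lemma query_eval_max (D : database S) (u : adom D) : P D -> qagg q = @max_agg R ->
  query_eval q (@lam D) u = (\row_j max_agg (seq_mset
    [seq ty_val t j | t <- enum {: ty} & ex_cls (qpoint q) (ty_conj t) u]))%R.
Proof.
move=> PD qs; apply/rowP => j; rewrite !mxE qs; apply: eq_mem_max_agg => x.
apply/mapP/mapP => [[h]|[t]].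
  rewrite mem_enum => hh ->; exists (ty_of h); last exact: prod_ty_val.
  rewrite mem_filter mem_enum andbT; apply/existsP; exists h.
  by rewrite ty_conjP hh eqxx.
rewrite mem_filter mem_enum andbT => /existsP[h];
  rewrite ty_conjP => /andP[hh /eqP <-] ->.
by exists h; rewrite ?mem_enum // prod_ty_val.
Qed.

Lemma det_query_max : cn = false -> qagg q = @max_agg R ->
  determined K P (fun D => query_eval q (@lam D)).
Proof.
move=> cn0 qs; have ke (t : ty) : determined K P (fun D u =>
  ex_cls (qpoint q) (ty_conj t) u).
  by apply/det_cls/(closed_ex cK) => //; rewrite cn0.
apply: det_ext (det_family (fun b : ty -> bool => \row_j max_agg (seq_mset
    [seq ty_val t j | t <- enum {: ty} & b t]))%R ke) _ => D u PD.
exact: query_eval_max.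
Qed.

Lemma det_query_sum : (forall t, determined K P (@ty_count t)) -> qagg q = @sum_agg R ->
  determined K P (fun D => query_eval q (@lam D)).
Proof.
move=> kt qs.
apply: det_ext (det_family (fun n : ty -> nat =>
  \row_j \sum_t ty_val t j *+ n t)%R kt) _ => D u PD.
exact: query_eval_sum.
Qed.

End QueryCounts.

(** By [card_hom_le] the count is at most [L], so [card_thresholds] turns it into the number of
    threshold tuples [ks] for which [c ks] holds, and each [c ks] is expressible by
    [cghml_count]. *)
Lemma det_count (S : schema) B (V : finType) (pt : V)
    (q : cconj (expressible (connected_GHML S)) V) :
  nqs q = [::] -> (forall v, reach (gaifman (ats q)) pt v) ->
  determined (expressible (connected_GHML S)) (fun D => degree D <= B)
   (fun D u => #|[pred h : {ffun V -> adom D} | (h pt == u) && cc_sat q h]|).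
Proof.
move=> nq rq; set K := expressible _.
pose L := ((B * max_ar S).+1 ^ #|V|) ^ #|V|.
pose c (ks : (size (others pt)).-tuple 'I_L) : classifier S := fun D u =>
  count_exists (succs ks) (fun ys => cc_sat q (fun v => nth u (u :: ys) (pos pt v))).
have kc ks : determined K (fun D => degree D <= B) (c ks).
  apply/det_cls/cghml_count => //; first by rewrite size_map size_tuple.
  by apply/allP => _ /mapP[k _ ->].
apply: det_ext (det_family (fun b : _ -> bool => #|[pred ks | b ks]|) kc) _ => D u dB.
have ext (h h' : V -> adom D) : h =1 h' -> cc_sat q h = cc_sat q h' by apply: eq_cc_sat.
rewrite (card_hom_tuple pt u ext).
rewrite (card_thresholds (L := L) (P := fun ys => cc_sat q (fun v =>
  nth u (u :: ys) (pos pt v)))) //.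
rewrite -(card_hom_tuple pt u ext).
apply: leq_trans (subset_leq_card _) (card_hom_le u rq dB).
by apply/subsetP => h; rewrite !inE => /andP[-> /and3P[]].
Qed.

(** * Whole networks as functions of finitely many classifiers *)

Section Layers.
Variables (R : realType) (S : schema).

Lemma layers_det (K : class S) (P : database S -> Prop) (W :
  forall d, query R S d -> Prop) d (N : layers R S d) :
  (forall d (q : query R S d) (lam : forall D :
    database S, adom D -> 'rV[R]_d), W d q ->
     determined K P lam -> determined K P (fun D => query_eval q (@lam D))) ->
  all_layers (fun d d' L => forall i, W d (@lquery R S d d' L i)) N ->
  determined K P (fun D => @layers_eval R S d N D).
Proof.
move=> qd; elim: N => [_|d1 d2 N IH L [/IH{}IH WL]]; first exact: det_const.
apply: (det_family (lcom L) (f := fun i D u =>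
  query_eval (lquery L i) (@layers_eval _ _ _ N D) u)) => i.
exact: qd (WL i) IH.
Qed.

Lemma all_layers_imp (P Q : forall d d', layer R S d d' -> Prop) d (N : layers R S d) :
  (forall d d' L, P d d' L -> Q d d' L) -> all_layers P N -> all_layers Q N.
Proof. by move=> PQ; elim: N => [|d1 d2 N IH L [/IH n /PQ l]]. Qed.

Lemma all_layers_and (P Q : forall d d', layer R S d d' -> Prop) d (N : layers R S d) :
  all_layers P N -> all_layers Q N -> all_layers (fun d d' L => P d d' L /\ Q d d' L) N.
Proof. by elim: N => [|d1 d2 N IH L] //= [/IH h p] [/h]. Qed.

(** Keeping [K] general covers two targets: HML, and the class of simple networks itself. *)
Lemma max_dhn_closed (K : class S) b c : cq_closed K b false ->
  agg_DHN S (@max_agg R) c -> exists2 c', K c' & forall D v, True -> c D v = c' D v.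
Proof.
move=> cK [N uN ->]; apply: (det_bool cK); apply: (det_comp (dcls N)).
apply: (layers_det (W := fun d q => qagg q = @max_agg R)) uN.
by move=> d q lam qs [dd [k e]]; apply: (det_query_max cK k e).
Qed.

Lemma sum_dhn_cghml B c : connected_agg_DHN S (@sum_agg R) c ->
  exists2 c', expressible (connected_GHML S) c' &
    forall D v, degree D <= B -> c D v = c' D v.
Proof.
move=> [N [uN cN] ->]; have cK := @cghml_closed S.
apply: (det_bool (P := fun D => degree D <= B) cK); apply: (det_comp (dcls N)).
apply: (layers_det (W := fun d q => qagg q = @sum_agg R /\ connected_pattern (qpat q))).
  move=> d q lam [qs cq] [dd [k e]];
    apply: (@det_query_sum _ _ _ _ _ _ cK _ _ k _ _ e) => // t.
  by apply: det_count => // v; apply: connected_patoms.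
by apply: all_layers_imp (all_layers_and uN cN) => d d' L [h1 h2] i; split.
Qed.

End Layers.

(** * Simple networks *)

Section PatternOf.
Variables (S : schema) (V : finType) (A : seq (fact S V)).
Local Open Scope fset_scope.

(** Patterns have natural numbers as vertices, so a finite type of vertices is embedded by its
    ranks. *)
Definition enc (v : V) : nat := enum_rank v.

Lemma enc_inj : injective enc.
Proof. by move=> v w /val_inj/enum_rank_inj. Qed.

Definition pat_facts : database S :=
  [fset f in [seq (fact_map enc f : {R : sym S & (ar R).-tuple nat}) | f <- A]].

Definition pat_dom : {fset nat} := [fset n in [seq enc v | v <- enum V]].

Lemma pat_domP : adom pat_facts `<=` pat_dom.
Proof.
apply/fsubsetP => n /adomP[f]; rewrite inE => /mapP[g _ ->].
by rewrite fargs_map => /mapP[v _ ->]; rewrite inE map_f // mem_enum.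
Qed.

Definition pat := Pattern pat_domP.

Lemma enc_in v : enc v \in pat_dom.
Proof. by rewrite inE map_f // mem_enum. Qed.

Definition pv (v : V) : padom pat := [` enc_in v].

Lemma pv_surj (x : padom pat) : exists v, pv v == x.
Proof.
have := valP x; rewrite inE => /mapP[v _ e]; exists v.
by apply/eqP/val_inj; rewrite /= e.
Qed.

Definition pv_inv (x : padom pat) : V := xchoose (pv_surj x).

Lemma pv_invK : cancel pv_inv pv.
Proof. by move=> x; apply/eqP/(xchooseP (pv_surj x)). Qed.

Lemma pvK : cancel pv pv_inv.
Proof. by move=> v; apply: enc_inj; have := congr1 val (pv_invK (pv v)). Qed.

Lemma pat_sat (D : database S) (h : padom pat -> adom D) :
  [forall f : {R : sym S & (ar R).-tuple (padom pat)},
    (fact_map val f \in pfacts pat) ==> (fact_map (val \o h) f \in D)] =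
  all (fun f => fact_map (val \o (h \o pv)) f \in D) A.
Proof.
apply/forallP/allP => [al f fA|al f].
  have := al (fact_map pv f); rewrite !fact_map_comp inE.
  by move/implyP; apply; apply: (map_f (fact_map enc)).
apply/implyP; rewrite inE => /mapP[g gA e].
(* [H] extends [h] to all naturals, with the arbitrary value 0 outside the pattern, so that equality
   of the encoded facts can be used under the map. *)
pose H n := if insub n is Some x then val (h x) else 0.
have H1 x : H (val x) = val (h x) by rewrite /H valK.
have -> : fact_map (val \o h) f = fact_map H (fact_map val f).
  by rewrite fact_map_comp; apply: eq_fact_map => x; rewrite /= H1.
rewrite e fact_map_comp (@eq_fact_map _ _ _ _ (val \o (h \o pv))) ?al //.
by move=> v /=; rewrite -H1.
Qed.

Lemma pat_connected pt : (forall v, reach (gaifman A) pt v) -> connected_pattern pat.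
Proof.
move=> rA; apply/forallP => x; apply/forallP => y; apply/reachP.
rewrite -(pv_invK x) -(pv_invK y).
have rxy : reach (gaifman A) (pv_inv x) (pv_inv y).
  by apply: (reach_trans _ (rA _)); apply: reach_sym (rA _); apply: gaifman_sym.
apply: reach_map rxy => v w /(gaifman_map enc); rewrite (inj_eq enc_inj).
case/orP=> [/eqP->|g]; first by rewrite eqxx.
apply/orP; right; apply: gaifman_sub g => f fA.
by rewrite inE.
Qed.

Lemma perm_hom_pat (D : database S) (pt : V) (u : adom D) :
  perm_eq [seq ([ffun v => h (pv v)] : {ffun V -> adom D}) |
      h : {ffun padom pat -> adom D} <- enum (Defs.Hom (pv pt) u)]
    (enum [pred g : {ffun V -> adom D} | (g pt == u) &&
       all (fun f => fact_map (val \o g) f \in D) A]).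
Proof.
pose G (h : {ffun padom pat -> adom D}) := [ffun v => h (pv v)].
have iG : injective G.
  move=> h h' /ffunP e; apply/ffunP => x.
  by have := e (pv_inv x); rewrite !ffunE pv_invK.
apply: uniq_perm; [by rewrite map_inj_uniq ?enum_uniq|exact: enum_uniq|].
have GE (h : {ffun padom pat -> adom D}) :
    (G h pt == u) && all (fun f => fact_map (val \o G h) f \in D) A =
    (h \in Defs.Hom (pv pt) u).
  rewrite inE /is_hom pat_sat ffunE; congr (_ && _); apply: eq_all => f.
  by congr (_ \in D); apply: eq_fact_map => v /=; rewrite ffunE.
move=> g; rewrite mem_enum inE; apply/mapP/idP => [[h]|gs].
  by rewrite mem_enum -GE => hh ->.
have gG : g = G [ffun x => g (pv_inv x)] by apply/ffunP => v; rewrite !ffunE pvK.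
by exists [ffun x => g (pv_inv x)] => //; rewrite mem_enum -GE -gG.
Qed.

End PatternOf.

Section Relu.
Variable R : realType.
Local Open Scope ring_scope.

Definition relu (t : R) : R := Num.min (Num.max 0 t) 1.

Lemma relu_nat n : relu n%:R = (0 < n)%N%:R.
Proof.
rewrite /relu max_r ?ler0n //; case: n => [|n]; first by rewrite min_l ?ler01.
by rewrite min_r // ler1n.
Qed.

Lemma relu0 : relu 0 = 0.
Proof. exact: (relu_nat 0). Qed.

Lemma relu_bool (b : bool) : relu b%:R = b%:R.
Proof. by rewrite relu_nat; case: b. Qed.

Lemma relu_1sub n : relu (1 - n%:R) = (n == 0)%N%:R.
Proof.
case: n => [|n]; first by rewrite subr0 -[1]/(1%:R) relu_nat.
rewrite /relu max_l ?min_l ?ler01 // subr_le0 ler1n //.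
Qed.

End Relu.

(* The scalar homomorphism query with transformations relu (x *m hw v + hb v),
   together with the coefficient hc of its result in the combination function. *)
Record hquery (S : schema) (d : nat) := HQuery {
  hc : rat;
  hV : finType;
  hpt : hV;
  hA : seq (fact S hV);
  hw : hV -> 'M[rat]_(d, 1);
  hb : hV -> rat }.

Arguments hw [S d] h v.
Arguments hb [S d] h v.

(** A single vertex without atoms has exactly one homomorphism, so this query evaluates a function
    of the embedding at the point. *)
Definition hunit (S : schema) d (w : 'M[rat]_(d, 1)) (b : rat) : hquery S d :=
  HQuery 1 tt [::] (fun=> w) (fun=> b).

(** * Extending simple networks layer by layer *)

Section Nets.
Variables (R : realType) (S : schema) (ag : aggregation R) (cn : bool).
Hypothesis ag1 : forall x, ag (seq_mset [:: x]) = x.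

Definition good_layer d d' (L : layer R S d d') : Prop :=
  [/\ forall i, qagg (lquery L i) = ag, simple_layer L &
      cn -> forall i, connected_pattern (qpat (lquery L i))].

Definition hq_trans d (x : 'rV[R]_d) (w : 'M[rat]_(d, 1)) (b : rat) : R :=
  relu ((x *m map_mx ratr w) ord0 ord0 + ratr b)%R.

Definition hq_eval d (Q : hquery S d) (D : database S) (lam : adom D -> 'rV[R]_d)
    (u : adom D) : R :=
  ag (seq_mset [seq (\prod_v hq_trans (lam (g v)) (hw Q v) (hb Q v))%R |
    g : {ffun hV Q -> adom D} <- enum [pred g : {ffun hV Q -> adom D} |
      (g (hpt Q) == u) && all (fun f => fact_map (val \o g) f \in D) (hA Q)]]).

Definition hq_query d (Q : hquery S d) : query R S d :=
  @Query R S d 1 isT (pat (hA Q)) (pv (hA Q) (hpt Q))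
    (fun x v => ReLUs (v *m map_mx ratr (hw Q (pv_inv x)) +
       map_mx ratr (const_mx (hb Q (pv_inv x))))%R) ag.

Lemma hq_queryE d (Q : hquery S d) (D : database S) (lam : adom D -> 'rV[R]_d) u :
  query_eval (hq_query Q) lam u ord0 ord0 = hq_eval Q lam u.
Proof.
rewrite mxE /hq_eval /=; congr ag; apply/eq_seq_msetP.
have := perm_map (fun g : {ffun hV Q -> adom D} =>
  (\prod_v hq_trans (lam (g v)) (hw Q v) (hb Q v))%R) (perm_hom_pat (hA Q) (hpt Q) u).
apply: perm_trans; rewrite -map_comp; rewrite (@eq_map _ _ _ (
 (fun g : {ffun hV Q -> adom D} =>
   (\prod_v hq_trans (lam (g v)) (hw Q v) (hb Q v))%R) \o
 (fun h : {ffun padom (pat (hA Q)) -> adom D} => [ffun v => h (pv (hA Q) v)]))) // =>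
   h /=.
rewrite (reindex (pv (hA Q))) /=; last first.
  by exists (@pv_inv _ _ (hA Q)) => x _; rewrite ?pvK ?pv_invK.
apply: eq_bigr => v _; rewrite ffunE pvK /ReLUs mxE [in LHS]mxE; congr (relu (_ + _)%R).
by rewrite !mxE.
Qed.

Section AddLayer.
Variables (d : nat) (Qs : seq (hquery S d)).

Definition hq_nth (k : nat) : hquery S d := nth (hunit S 0 0)%R Qs k.

(** Its one homomorphism lets it pass on the old embedding, shifted by one; coordinate 0 is left at
    0 to receive the new value. *)
Definition copy_query : query R S d :=
  @Query R S d (1 + d) isT (pat ([::] : seq (fact S unit))) (pv [::] tt)
    (fun _ x => ReLUs (x *m map_mx ratr (row_mx 0 1%:M :
      'M_(d, 1 + d)) + map_mx ratr 0)%R) ag.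

Definition add_q (o : option 'I_(size Qs)) : query R S d :=
  if o is Some k then hq_query (hq_nth k) else copy_query.

Definition add_mx (o : option 'I_(size Qs)) : 'M[rat]_(qdim (add_q o), 1 + d) :=
  match o with
  | Some k => row_mx (hc (hq_nth k))%:M 0%R
  | None => 1%:M%R
  end.

(** Query 0 is the copy, and the queries of [Qs] follow; their combination with coefficients [hc]
    enters coordinate 0 only. *)
Definition add_layer : layer R S d (1 + d) :=
  @Layer R S d (1 + d) (size Qs).+1 (fun i => add_q (unlift ord0 i))
   (fun x => ReLUs (\sum_i x i *m map_mx ratr (add_mx (unlift ord0 i)) + map_mx ratr
     0)%R).

Lemma add_layer_good :
  (cn -> forall k, (k < size Qs)%N -> forall v,
    reach (gaifman (hA (hq_nth k))) (hpt (hq_nth k)) v) ->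
  good_layer add_layer.
Proof.
move=> rQ; split=> [i| |c i] /=; first by case: unliftP.
- split; first by eexists; eexists => x; reflexivity.
  by move=> i /=; case: (unlift _ _) => [k|] v /=; eexists; eexists => x; reflexivity.
- case: (unlift _ _) => [k|] /=; first exact: pat_connected (rQ c k (ltn_ord k)).
  by apply: (@pat_connected _ _ _ tt) => -[]; apply: reach_refl.
Qed.

Lemma copy_queryE (D : database S) (lam : adom D -> 'rV[R]_d) (u : adom D) :
  query_eval copy_query lam u = ReLUs (row_mx 0 (lam u))%R.
Proof.
have homE : Defs.Hom (pv [::] tt) u =i pred1 [ffun=> u].
  move=> h; rewrite inE /is_hom pat_sat /= andbT; apply/eqP/eqP => [e|->];
    last by rewrite ffunE.
  by apply/ffunP => x; rewrite -(@pv_invK S unit [::] x) ffunE; case: (pv_inv x).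
apply/rowP => j; rewrite mxE /= (eq_enum homE) enum1 /= ag1.
rewrite (reindex (@pv S unit [::])) /=; last first.
  by exists (@pv_inv S unit [::]) => x _; rewrite ?pvK ?pv_invK.
rewrite (big_pred1 tt) => [|[]//];
  rewrite ffunE map_mx0 addr0 map_row_mx map_mx0 map_mx1.
by rewrite mul_mx_row mulmx0 mulmx1.
Qed.

(** Old coordinates pass through ReLU* twice, in the transformation and in the combination. Boolean
    ones are unchanged by this, which is why only they are tracked. *)
Lemma add_layer_eval (D : database S) (lam : adom D -> 'rV[R]_d) (u : adom D) :
  layer_eval add_layer lam u ord0 (lshift d ord0) =
    relu (\sum_(Q <- Qs) ratr (hc Q) * hq_eval Q lam u)%R /\
  forall j, layer_eval add_layer lam u ord0 (rshift 1 j) = relu (relu (lam u ord0 j)).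
Proof.
have E j : layer_eval add_layer lam u ord0 j = relu ((ReLUs (row_mx 0 (lam u))) ord0 j +
    \sum_(k < size Qs) (query_eval (hq_query (hq_nth k)) lam u *m
      row_mx (ratr (hc (hq_nth k)))%:M 0) ord0 j)%R.
  rewrite /layer_eval /= /ReLUs mxE map_mx0 addr0 summxE big_ord_recl /= unlift_none /=.
  rewrite copy_queryE map_mx1 mulmx1; congr (relu (_ + _)%R); apply: eq_bigr => k _.
  by rewrite liftK /= map_row_mx map_mx0 map_scalar_mx.
split=> [|j]; rewrite E /ReLUs mxE.
  rewrite row_mxEl mxE -[Num.min _ _]/(relu _) relu0 add0r.
  congr relu; rewrite [RHS](big_nth (hunit S 0 0)) big_mkord; apply: eq_bigr => k _.
  by rewrite mul_mx_row row_mxEl mul_mx_scalar mxE hq_queryE.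
rewrite row_mxEr -[Num.min _ _]/(relu _) big1 ?addr0 // => k _.
by rewrite mul_mx_row row_mxEr mulmx0 mxE.
Qed.

End AddLayer.

Definition good_net d (N : layers R S d) : Prop := all_layers good_layer N.

Definition bit d (N : layers R S d) (c : classifier S) : Prop :=
  exists j, forall (D : database S) (u :
    adom D), layers_eval N u ord0 j = ((c D u)%:R)%R.

Definition extends d (N : layers R S d) d' (N' : layers R S d') : Prop :=
  forall c, bit N c -> bit N' c.

(* Every good net can be extended, keeping its Boolean coordinates, so as to
   compute c: this lets nets of different depths be merged one after another. *)
Definition net_class : class S := fun c => forall d (N : layers R S d),
  good_net N -> exists d' (N' :
    layers R S d'), [/\ good_net N', extends N N' & bit N' c].

Lemma net_add d (N : layers R S d) (Qs : seq (hquery S d)) (c : classifier S) :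
  good_net N ->
  (cn -> forall k, (k < size Qs)%N -> forall v,
    reach (gaifman (hA (hq_nth Qs k))) (hpt (hq_nth Qs k)) v) ->
  (forall (D : database S) (u : adom D),
    relu (\sum_(Q <- Qs) ratr (hc Q) * hq_eval Q (@layers_eval R S d N D) u)%R = ((c
      D u)%:R)%R) ->
  exists d' (N' : layers R S d'), [/\ good_net N', extends N N' & bit N' c].
Proof.
move=> gN rQ e; exists (1 + d)%N, (AddLayer N (add_layer Qs)); split.
- by split=> //; apply: add_layer_good.
- move=> c' [j ej]; exists (rshift 1 j) => D u /=.
  by rewrite (proj2 (add_layer_eval _ _ _)) ej !relu_bool.
- by exists (lshift d ord0) => D u /=; rewrite (proj1 (add_layer_eval _ _ _)) e.
Qed.

Lemma hq_eval_unit d w b (D : database S) (lam : adom D -> 'rV[R]_d) (u : adom D) :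
  hq_eval (hunit S w b) lam u = hq_trans (lam u) w b.
Proof.
rewrite /hq_eval /= (eq_enum (B := pred1 [ffun=> u])) => [|g].
  by rewrite enum1 /= ag1 (big_pred1 tt) ?ffunE // => -[].
rewrite !inE andbT; apply/eqP/eqP => [e|->]; last by rewrite ffunE.
by apply/ffunP => -[]; rewrite ffunE.
Qed.

Lemma net_local d (N : layers R S d) w b (c : classifier S) : good_net N ->
  (forall (D : database S) (u : adom D),
     hq_trans (layers_eval N u) w b = ((c D u)%:R)%R) ->
  exists d' (N' : layers R S d'), [/\ good_net N', extends N N' & bit N' c].
Proof.
move=> gN e; apply: (@net_add _ _ [:: hunit S w b]) => //.
  by move=> _ [|//] _ []; apply: reach_refl.
by move=> D u; rewrite big_seq1 hq_eval_unit e /= rmorph1 mul1r relu_bool.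
Qed.

Lemma mul_delta_col d (x : 'rV[R]_d) j :
  ((x *m map_mx ratr (delta_mx j ord0 : 'M[rat]_(d, 1))) ord0 ord0 = x ord0 j)%R.
Proof.
rewrite mxE (bigD1 j) //= !mxE !eqxx rmorph1 mulr1 big1 ?addr0 // => i ij.
by rewrite !mxE (negbTE ij) rmorph0 mulr0.
Qed.

Lemma extends_trans d1 (N1 : layers R S d1) d2 (N2 : layers R S d2) d3 (N3 :
  layers R S d3) :
  extends N1 N2 -> extends N2 N3 -> extends N1 N3.
Proof. by move=> e1 e2 c /e1/e2. Qed.

Lemma bit_ext d (N : layers R S d) (c c' : classifier S) :
  bit N c -> (forall D v, c D v = c' D v) -> bit N c'.
Proof. by case=> j e e'; exists j => D u; rewrite e e'. Qed.

Lemma net_ext (c c' : classifier S) :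
  net_class c -> (forall D v, c D v = c' D v) -> net_class c'.
Proof.
move=> nc e d N /nc[d' [N' [g x b]]]; exists d', N'; split=> //; exact: bit_ext b e.
Qed.

Lemma net_true : net_class (fun _ _ => true).
Proof.
move=> d N gN; apply: (@net_local _ _ 0%R 1%R) => // D u.
by rewrite /hq_trans map_mx0 mulmx0 mxE add0r rmorph1 -[1%R]/((true%:R)%R :
  R) relu_bool.
Qed.

Lemma net_neg (c : classifier S) : net_class c -> net_class (fun D v => ~~ c D v).
Proof.
move=> nc d N /nc[d' [N' [g x [j ej]]]].
have h D (u : adom D) : (hq_trans (layers_eval N' u) (- delta_mx j ord0) 1 = (~~ c D
  u)%:R)%R.
  (* Negation is [1 - x]. *)
  rewrite /hq_trans map_mxN mulmxN mxE mul_delta_col ej rmorph1 addrC.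
  by rewrite relu_1sub; case: (c D u).
have [d2 [N2 [g2 x2 b2]]] := net_local g h.
by exists d2, N2; split=> //; apply: extends_trans x x2.
Qed.

Lemma net_or (c c' : classifier S) :
  net_class c -> net_class c' -> net_class (fun D v => c D v || c' D v).
Proof.
move=> nc nc' d N /nc[d1 [N1 [g1 x1 b1]]].
have [d' [N' [g x /[dup] b' [j' ej']]]] := nc' _ _ g1.
have [j ej] := x _ b1.
have h D (u : adom D) :
    (hq_trans (layers_eval N' u) (delta_mx j ord0 + delta_mx j' ord0) 0 = (c D u ||
      c' D u)%:R)%R.
  (* Disjunction is [x + y] cut off at 1. *)
  rewrite /hq_trans map_mxD mulmxDr mxE !mul_delta_col ej ej' rmorph0 addr0.
  by rewrite -natrD relu_nat; case: (c D u); case: (c' D u).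
have [d2 [N2 [g2 x2 b2]]] := net_local g h.
by exists d2, N2; split=> //; apply: extends_trans x1 (extends_trans x x2).
Qed.

End Nets.

(** * Existential conjunctions by simple networks *)

Lemma prod_natr_bool (R : comNzRingType) (I : finType) (b : I -> bool) :
  (\prod_i (b i)%:R = [forall i, b i]%:R :> R)%R.
Proof.
case: (boolP [forall i, b i]) => [/forallP al|/forallPn[i /negbTE bi]].
  by rewrite big1 // => i _; rewrite al.
by rewrite (bigD1 i) //= bi mul0r.
Qed.

Lemma max_agg_nil (R : realType) : max_agg (seq_mset [::]) = 0%R :> R.
Proof.
have := perm_size (perm_eq_seq_mset ([::] : seq R)).
by rewrite /max_agg; case: (enum_mset _).
Qed.

(** On a nonempty list of Booleans the maximum is their disjunction; the convention that the empty
    maximum is 0 extends this to the case of no homomorphism. *)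
Lemma max_agg_bool (R : realType) (T : eqType) (s : seq T) (b : T -> bool) :
  (max_agg (seq_mset [seq (b x)%:R | x <- s]) = (has b s)%:R :> R)%R.
Proof.
case: s => [|x0 s]; first exact: max_agg_nil.
have [] // := @max_agg_seqP R [seq (b x)%:R%R | x <- x0 :: s].
set m := max_agg _; set t := x0 :: s => /mapP[x xt mE] ml.
rewrite mE; case: (boolP (has b t)) => [/hasP[y yt by_]|/hasPn ns];
  last by rewrite (negbTE (ns x xt)).
have := ml (b y)%:R%R (map_f _ yt); rewrite mE by_.
by case: (b x) => //; rewrite lern0.
Qed.

(** * Inclusion-exclusion over quotients of a pattern *)

Section ExclIncl.
Variables (S : schema) (I : Type) (cn : bool).

(** Unary conjuncts are mere indices, interpreted by [B] only when counting, so that one linear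
    combination of quotients serves all databases and interpretations. *)
Record icq := ICq {
  iV : finType;
  ipt : iV;
  iA : seq (fact S iV);
  iun : seq (iV * I) }.

Definition iconn (Q : icq) := cn -> forall v, reach (gaifman (iA Q)) (ipt Q) v.

Definition isat (D : database S) (B : I -> adom D -> bool) (u : adom D) (Q :
  icq) (h : iV Q -> adom D) :=
  [&& h (ipt Q) == u, all (fun f => fact_map (val \o h) f \in D) (iA Q) &
      all (fun p => B p.2 (h p.1)) (iun Q)].

Definition icount (D : database S) (B : I -> adom D -> bool) (u : adom D) (Q :
  icq) nq :=
  #|[pred h : {ffun iV Q -> adom D} | isat B u h && all (fun p => h p.1 != h p.2) nq]|.

Definition imap (Q : icq) (W : finType) (pi : iV Q -> W) : icq :=
  ICq (pi (ipt Q)) [seq fact_map pi f | f <- iA Q] [seq (pi p.1, p.2) | p <- iun Q].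

Lemma isat_map D (B : I -> adom D -> bool) u Q (W : finType) (pi : iV Q -> W) (h :
  W -> adom D) :
  isat B u (Q := imap pi) h = isat B u (h \o pi).
Proof.
rewrite /isat /= !all_map; congr [&& _, _ & _].
by apply: eq_all => f /=; rewrite fact_map_comp.
Qed.

Lemma eq_isat D (B : I -> adom D -> bool) u Q (h h' : iV Q -> adom D) :
  h =1 h' -> isat B u h = isat B u h'.
Proof.
move=> e; rewrite /isat e; congr [&& _, _ & _].
  by apply: eq_all => f; congr (_ \in D); apply: eq_fact_map => x /=; rewrite e.
by apply: eq_all => p; rewrite e.
Qed.

Section Quotient.
Variables (V : finType) (a b : V).
Hypothesis ab : a != b.
Local Notation W := {v : V | v != b}.

(** The quotient identifying [a] and [b] is represented by the vertices other than [b]; as [b] lies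
    outside this subtype, it is sent to the default [a]. *)
Definition merge (v : V) : W := insubd (exist _ a ab : W) v.

Lemma mergeK (w : W) : merge (val w) = w.
Proof. by rewrite /merge valKd. Qed.

Lemma merge_val v : val (merge v) = if v == b then a else v.
Proof. by rewrite /merge val_insubd; case: eqP. Qed.

Lemma card_merge (T : finType) (P : (V -> T) -> bool) :
  (forall h h', h =1 h' -> P h = P h') ->
  #|[pred h : {ffun W -> T} | P (h \o merge)]| =
  #|[pred h : {ffun V -> T} | P h && (h a == h b)]|.
Proof.
move=> ext; pose G (h : {ffun W -> T}) := [ffun v => h (merge v)].
have iG : injective G.
  move=> h h' /ffunP e; apply/ffunP => w; have := e (val w).
  by rewrite !ffunE mergeK.
have PG h : P (G h) = P (h \o merge) by apply: ext => v; rewrite ffunE.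
rewrite -(card_imset _ iG); apply: eq_card => h; apply/imsetP/idP => [[g]|].
  rewrite !inE -PG => Pg ->; rewrite Pg !ffunE; apply/eqP; congr (g _).
  by apply: val_inj; rewrite !merge_val eqxx (negbTE ab).
rewrite inE => /andP[Ph /eqP hab]; pose g := [ffun w : W => h (val w)].
have hG : h = G g.
  by apply/ffunP => v; rewrite !ffunE merge_val; case: eqP => // ->.
by exists g; rewrite // inE -PG -hG.
Qed.

End Quotient.

(* Inclusion-exclusion: the homomorphisms violating h a != h b are those of the
   quotient that identifies a and b. *)
Lemma excl_incl (R : realType) (Q : icq) (nq : seq (iV Q * iV Q)) : iconn Q ->
  exists l : seq (rat * icq), foldr (fun x P => iconn x.2 /\ P) True l /\
   forall D (B : I -> adom D -> bool) u,
    ((icount B u nq)%:R = \sum_(x <- l) ratr x.1 * (icount B u (Q := x.2) [::])%:R :>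
      R)%R.
Proof.
(* The induction is on a bound for the number of inequalities, because the quotient changes the type
   of vertices. *)
move: {2}(size nq) (leqnn (size nq)) => n;
  elim: n Q nq => [|n IH] Q [|[a b] nq] //= sz cQ.
- by exists [:: (1%R, Q)]; split=> // D B u; rewrite big_seq1 /= rmorph1 mul1r.
- by exists [:: (1%R, Q)]; split=> // D B u; rewrite big_seq1 /= rmorph1 mul1r.
have [ab|ab] := eqVneq a b.
  (* An inequality of a vertex with itself has no solution, so the empty combination is correct. *)
  exists [::]; split=> // D B u; rewrite big_nil /icount eq_card0 // => h.
  by rewrite inE /= ab eqxx andbF.
have [l [cl El]] := IH Q nq sz cQ.
pose Q' := imap (merge ab); pose nq' := [seq (merge ab p.1, merge ab p.2) | p <- nq].
have cQ' : iconn Q'.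
  move=> c w; have := @reach_gaifman_map S _ _ (merge ab) _ _ _ (cQ c (val w)).
  by rewrite mergeK.
have sz' : size nq' <= n by rewrite size_map.
have [l' [cl' El']] := IH Q' nq' sz' cQ'.
exists (l ++ [seq (- x.1, x.2)%R | x <- l']); split.
  elim: l cl {El} => [_|x l IHl [cx /IHl]] //=.
  by elim: l' cl' {El'} => [|x l IHl [cx /IHl]].
move=> D B u; rewrite big_cat big_map /=.
have -> : (\sum_(x <- l') ratr (- x.1) * (icount B u (Q := x.2) [::])%:R = - (icount
  B u (Q := Q') nq')%:R :> R)%R.
  by rewrite El' -sumrN; apply: eq_bigr => x _; rewrite rmorphN mulNr.
rewrite -El; apply/eqP; rewrite eq_sym subr_eq -natrD eqr_nat; apply/eqP.
pose P (h : iV Q -> adom D) := isat B u h && all (fun p => h p.1 != h p.2) nq.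
have ext h h' : h =1 h' -> P h = P h'.
  by move=> e; rewrite /P (eq_isat _ _ e); congr (_ && _); apply: eq_all => p;
    rewrite !e.
have -> : icount B u (Q := Q') nq' = #|[pred h :
  {ffun iV Q -> adom D} | P h && (h a == h b)]|.
  rewrite -(card_merge ab ext); apply: eq_card => h; rewrite !inE.
  by rewrite isat_map all_map.
rewrite /icount -!sum1_card addnC (bigID (fun h : {ffun iV Q -> adom D} =>
  h a == h b)) /=.
congr (_ + _); apply: eq_bigl => h; rewrite !inE //.
by rewrite /P /=; case: (h a == h b); rewrite ?andbT ?andbF.
Qed.

End ExclIncl.

(** * Existential quantification by one additional layer *)

Section NetEx.
Variables (R : realType) (S : schema) (ag : aggregation R) (cn : bool).
Hypothesis ag1 : forall x, ag (seq_mset [:: x]) = x.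
Local Notation K := (net_class ag cn : class S).

Section Bits.
Variables (d : nat) (N : layers R S d).

(** The coordinate takes only the values 0 and 1; [bval] then recovers its truth value. *)
Definition isbit (j : 'I_d) : Prop := forall (D : database S) (u : adom D),
  (layers_eval N u ord0 j = (layers_eval N u ord0 j == 1)%:R)%R.

Definition bval (i : {j | isbit j}) (D : database S) (u : adom D) : bool :=
  (layers_eval N u ord0 (sval i) == 1)%R.

Local Notation bicq := (icq S {j | isbit j}).

Definition conj_hq (c : rat) (Q : bicq) : hquery S d :=
  HQuery c (ipt Q) (iA Q)
    (fun v => \sum_(p <- iun Q | p.1 == v) delta_mx (sval p.2) ord0)%R
    (fun v => 1 - (count (fun p => p.1 == v) (iun Q))%:R)%R.

(* With x_1, ..., x_k Boolean, x_1 + ... + x_k + 1 - k is positive only if all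
   of them are 1. *)
Lemma conj_trans c (Q : bicq) v (D : database S) (u : adom D) :
  (hq_trans (layers_eval N u) (hw (conj_hq c Q) v) (hb (conj_hq c Q) v) =
   (all (fun p => (p.1 == v) ==> bval p.2 u) (iun Q))%:R)%R.
Proof.
rewrite /hq_trans /=.
have -> : ((layers_eval N u *m map_mx ratr
    (\sum_(p <- iun Q | p.1 == v) delta_mx (sval p.2) ord0 : 'M[rat]_(d, 1))) ord0 ord0
    + ratr (1 - (count (fun p => p.1 == v) (iun Q))%:R) =
    1 - (count (fun p => (p.1 == v) && ~~ bval p.2 u) (iun Q))%:R :> R)%R.
  rewrite rmorphB rmorph1 rmorph_nat; elim: (iun Q) => [|p s IH] /=.
    by rewrite big_nil map_mx0 mulmx0 mxE add0r.
  rewrite big_cons; case: (p.1 == v) => //=.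
  rewrite map_mxD mulmxDr mxE mul_delta_col (proj2_sig p.2) -/(bval p.2 u) !natrD.
  by case: (bval p.2 u) => /=; lra.
rewrite relu_1sub; congr (_%:R)%R; congr nat_of_bool.
rewrite -leqn0 leqNgt -has_count -all_predC; apply: eq_all => p /=.
by rewrite negb_and negbK implybE.
Qed.

Lemma conj_hq_eval c (Q : bicq) (D : database S) (u : adom D) :
  hq_eval ag (conj_hq c Q) (@layers_eval R S d N D) u =
  ag (seq_mset [seq (all (fun p => bval p.2 (g p.1)) (iun Q))%:R%R |
    g : {ffun iV Q -> adom D} <- enum [pred g : {ffun iV Q -> adom D} |
      (g (ipt Q) == u) && all (fun f => fact_map (val \o g) f \in D) (iA Q)]]).
Proof.
rewrite /hq_eval; congr (ag (seq_mset _)); apply: eq_map => g.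
under eq_bigr do rewrite conj_trans.
rewrite prod_natr_bool; congr (_%:R)%R; congr nat_of_bool.
apply/forallP/idP => [al|].
  elim: (iun Q) al => [|p s IH] //= al.
  have := al p.1; rewrite eqxx /= => /andP[-> _] /=; apply: IH => v.
  by case/andP: (al v).
move=> al v; elim: (iun Q) al => [|p s IH] //= /andP[bp /IH ->].
by rewrite andbT; apply/implyP => /eqP <-.
Qed.

End Bits.

(** The networks of the unary conjuncts are stacked one on another, and [extends] keeps the earlier
    bits until all of them are coordinates of the same network. *)
Lemma net_collect (V : Type) (un : seq (V * {c : classifier S | K c})) d (N :
  layers R S d) :
  good_net ag cn N -> exists d' (N' : layers R S d'),
  [/\ good_net ag cn N', extends N N' & exists js : seq (V * {j | isbit N' j}),
    forall D (h : V -> adom D),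
      all (fun p => sval p.2 D (h p.1)) un = all (fun p => bval p.2 (h p.1)) js].
Proof.
move=> gN.
have [d' [N' [g x bs]]] : exists d' (N' : layers R S d'),
    [/\ good_net ag cn N', extends N N' & foldr (fun p P =>
      bit N' (sval p.2) /\ P) True un].
  elim: un => [|p un [d1 [N1 [g1 x1 b1]]]]; first by exists d, N; split.
  have [d2 [N2 [g2 x2 b2]]] := proj2_sig p.2 _ _ g1.
  exists d2, N2; split=> //; first exact: extends_trans x1 x2.
  by split=> //; elim: (un) b1 => [|p' s IH] //= [/x2 h1 /IH].
exists d', N'; split=> //; elim: un bs => [_|p un IH /= [[j ej] /IH[js E]]];
  first by exists [::].
have bj : isbit N' j.
  by move=> D u; rewrite ej; case: (sval p.2 D u); rewrite ?eqxx // eq_sym oner_eq0.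
exists ((p.1, exist _ j bj) :: js) => D h /=; rewrite E; congr (_ && _).
by rewrite /bval /= ej; case: (sval p.2 D _); rewrite ?eqxx // eq_sym oner_eq0.
Qed.

Lemma ex_cls_icount (V : finType) (pt : V) (q : cconj K V) d (N : layers R S d)
    (js : seq (V * {j | isbit N j})) (D : database S) (u : adom D) :
  (forall D (h : V -> adom D),
      all (fun p => sval p.2 D (h p.1)) (uns q) = all (fun p => bval p.2 (h p.1)) js) ->
  ex_cls pt q u = (0 < icount (@bval _ N ^~ D) u (Q := ICq pt (ats q) js) (nqs q)).
Proof.
move=> E; apply/existsP/card_gt0P => -[h]; rewrite ?inE => hh; exists h; move: hh;
  by rewrite ?inE /isat /cc_sat /= E -!andbA.
Qed.

Lemma net_ex_max (V : finType) (pt : V) (q : cconj K V) :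
  (forall (T : eqType) (s : seq T) (b : T -> bool),
     (ag (seq_mset [seq (b x)%:R | x <- s]) = (has b s)%:R)%R) ->
  nqs q = [::] -> (cn -> forall v, reach (gaifman (ats q)) pt v) ->
  K (ex_cls pt q).
Proof.
move=> agb nq rq d N /(net_collect (uns q))[d1 [N1 [g1 x1 [js E]]]].
pose Q := ICq pt (ats q) js.
have [|D u|d2 [N2 [g2 x2 b2]]] := @net_add _ _ _ _ ag1 _ N1 [:: conj_hq 1 Q] (ex_cls
  pt q) g1.
- by move=> c [|//] _ v; apply: rq.
- rewrite big_seq1 /= rmorph1 mul1r conj_hq_eval agb relu_bool.
  congr (_%:R)%R; congr nat_of_bool; apply/hasP/existsP => [[h]|[h]].
    rewrite mem_enum inE => /andP[hu hA] hj; exists h.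
    by rewrite /cc_sat nq hu hA E hj.
  by rewrite /cc_sat nq E => /and3P[hu hA /andP[hj _]]; exists h;
    rewrite ?mem_enum ?inE ?hu.
by exists d2, N2; split=> //; apply: extends_trans x1 x2.
Qed.

(** The signed combination from [excl_incl] equals the number of homomorphisms that respect the
    inequalities, a natural number, which ReLU* turns into its positivity. *)
Lemma net_ex_sum (V : finType) (pt : V) (q : cconj K V) : ag = @sum_agg R ->
  (cn -> forall v, reach (gaifman (ats q)) pt v) -> K (ex_cls pt q).
Proof.
move=> agE rq d N /(net_collect (uns q))[d1 [N1 [g1 x1 [js E]]]].
pose Q := ICq pt (ats q) js.
have [l [cl El]] := @excl_incl S _ cn R Q (nqs q) rq.
have [|D u|d2 [N2 [g2 x2 b2]]] := @net_add _ _ _ _ ag1 _ N1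
  [seq conj_hq x.1 x.2 | x <- l] (ex_cls pt q) g1.
- move=> c k; rewrite size_map /hq_nth;
  elim: l cl {El} k => [|x l IH] //= [cx /IH{}IH] [_ v|k] /=; first exact: cx.
  by rewrite ltnS; apply: IH.
- rewrite (ex_cls_icount _ _ E) -relu_nat El big_map; congr relu.
  apply: eq_bigr => x _; congr (_ * _)%R; rewrite conj_hq_eval agE sum_agg_seq big_map.
  rewrite big_enum /= -natr_sum /icount -sum1_card; congr (_%:R)%R.
  rewrite big_mkcond [RHS]big_mkcond; apply: eq_bigr => h _.
  by rewrite !inE /isat andbT andbA; case: (_ && _); case: (all _ _).
by exists d2, N2; split=> //; apply: extends_trans x1 x2.
Qed.

(** Extending the network without layers gives one having a coordinate equal to [c], which is read
    off by the test [> 0]. *)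
Lemma net_class_simple c : K c -> exists2 N : dhn R S,
  [/\ uses_agg ag N, simple_dhn N & cn -> connected_dhn N] &
  forall D v, c D v = dhn_accepts N v.
Proof.
move=> /(_ 0 (NoLayer R S) I)[d [N [g _ [j ej]]]].
exists (DHN N (fun x => x ord0 j > ratr 0)%R).
  split.
  - by apply: all_layers_imp g => d1 d2 L [].
  - split; first by apply: all_layers_imp g => d1 d2 L [].
    by exists j, 0%R; left.
  - by move=> c0; apply: all_layers_imp g => d1 d2 L [_ _]; apply.
by move=> D v; rewrite /dhn_accepts /= ej rmorph0 ltr0n; case: (c D v).
Qed.

End NetEx.

(** * Closure of simple networks and comparison of the classes *)

Lemma max_agg1 (R : realType) (x : R) : max_agg (seq_mset [:: x]) = x.
Proof.
have [] // := @max_agg_seqP R [:: x].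
by rewrite inE => /eqP.
Qed.

Lemma sum_agg1 (R : realType) (x : R) : sum_agg (seq_mset [:: x]) = x.
Proof. by rewrite sum_agg_seq big_seq1. Qed.

Lemma max_net_closed (R : realType) (S : schema) :
  cq_closed (net_class (@max_agg R) false : class S) false false.
Proof.
have a1 := @max_agg1 R; split.
- exact: net_ext.
- exact: net_true.
- exact: net_neg.
- exact: net_or.
- by move=> V pt q nq _; apply: net_ex_max; [|exact: max_agg_bool|exact: nq|].
Qed.

Lemma sum_net_closed (R : realType) (S : schema) cn :
  cq_closed (net_class (@sum_agg R) cn : class S) true cn.
Proof.
have a1 := @sum_agg1 R; split.
- exact: net_ext.
- exact: net_true.
- exact: net_neg.
- exact: net_or.
- by move=> V pt q _ rq; apply: net_ex_sum.
Qed.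

Theorem theorem7 (R : realType) (S : schema) :
  (same_power (agg_DHN S (@max_agg R)) (simple_agg_DHN S (@max_agg R)) /\
   same_power (simple_agg_DHN S (@max_agg R)) (HML S) /\
   (0 < #|sym S| -> same_power (HML S) (UNFO S))) /\
  (at_least_as_expressive (simple_agg_DHN S (@sum_agg R)) (GHML S) /\
   at_least_as_expressive (simple_agg_DHN S (@sum_agg R)) (UNFOC S)) /\
  (forall B : nat,
   same_power_on (fun D : database S => degree D <= B)
     (connected_agg_DHN S (@sum_agg R)) (simple_connected_agg_DHN S (@sum_agg R)) /\
   same_power_on (fun D : database S => degree D <= B)
     (simple_connected_agg_DHN S (@sum_agg R)) (connected_GHML S)).
Proof.
have sub P C1 C2 : (forall c, C1 c -> C2 c) -> @at_least_as_expressive_on S P C2 C1.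
  by move=> h c /h; exists c.
have net_max P C1 : (forall c, C1 c -> exists2 c', net_class (@max_agg R) false c' &
    forall D v, P D -> c D v = c' D v) -> at_least_as_expressive_on P (simple_agg_DHN
      S (@max_agg R)) C1.
  move=> h; apply: expressible_power => c /h[c' /net_class_simple[N [u s _] e] e'].
  by exists c' => //; exists (dhn_accepts N) => //; exists N.
have net_sum P C1 : (forall c, C1 c -> exists2 c', net_class (@sum_agg R) false c' &
    forall D v, P D -> c D v = c' D v) -> at_least_as_expressive_on P (simple_agg_DHN
      S (@sum_agg R)) C1.
  move=> h; apply: expressible_power => c /h[c' /net_class_simple[N [u s _] e] e'].
  by exists c' => //; exists (dhn_accepts N) => //; exists N.
have net_conn P C1 : (forall c, C1 c -> exists2 c', net_class (@sum_agg R) true c' &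
    forall D v, P D -> c D v = c' D v) ->
    at_least_as_expressive_on P (simple_connected_agg_DHN S (@sum_agg R)) C1.
  move=> h; apply: expressible_power => c /h[c' /net_class_simple[N [u s k] e] e'].
  by exists c' => //; exists (dhn_accepts N) => //; exists N => //; split=> //;
    apply: k.
have unfoc_in K b c : cq_closed K b false -> (exists2 phi : unfoc S,
    [/\ ~~ b -> is_unfo phi, unfoc_wf phi & (#|` unfoc_fv phi| <= 1)%fset] & c =
      unfoc_accepts phi) -> K c.
  move=> cK [phi [u w _] ->].
  by apply: (closed_ext cK (nf_closed cK (closed_unfoc cK w u) _)).
have sum_closed cn := @sum_net_closed R S cn; have max_closed := @max_net_closed R S.
split; [split; [|split]|split; [split|move=> B; split]].
(* The classifiers that determine a max network are taken among simple networks, so no formula is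
   involved here. *)
- split; first by apply: net_max => c; apply: max_dhn_closed max_closed.
  by apply: sub => c [N [u _] e]; exists N.
- split; last by apply: net_max => c [phi ->]; eexists;
  [exact: (closed_hml max_closed phi)|].
  apply: expressible_power => c [N [u _] e].
  by apply: (@max_dhn_closed R S _ _ c (@hml_closed S)); exists N.
- move=> S0; split.
    apply: expressible_power => c [phi ->]; eexists; last by move=> D v _; reflexivity.
    exact: (closed_hml (unfo_closed S0) phi).
  apply: expressible_power => c [phi [u w f] e]; exists c => //.
  by apply: (unfoc_in _ false _ (@hml_closed S)); exists phi.
- by apply: net_sum => c [phi ->]; eexists;
  [exact: (closed_ghml (sum_closed false) (phi := phi))|].
- apply: net_sum => c [phi [w f] e]; exists c => //.
  by apply: (unfoc_in _ true _ (sum_closed false)); exists phi.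
- split; last by apply: sub => c [N [u _ k] e]; exists N.
  (* Here the simplification goes through logic: on degree at most [B] the network agrees with a
     connected GHML formula, which a simple connected network then computes on all databases. *)
  apply: net_conn => c /(sum_dhn_cghml B)[c' [_ [phi cphi ->] e'] e].
  exists (fun D v => ghml_sat phi v);
    first exact: (closed_ghml (sum_closed true) (phi := phi)).
  by move=> D v /e ->; apply: e'.
- split.
    apply: expressible_power => c [N [u s k] e].
    by apply: (@sum_dhn_cghml R S B c); exists N.
  apply: net_conn => c [phi cphi ->]; exists (fun D v => ghml_sat phi v) => //.
  exact: (closed_ghml (sum_closed true) (phi := phi)).
Qed.
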